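(* Assume the following two conditions. (1) There exists $\varepsilon\in(0,1)$ and, for each $\theta\in\Theta$, $y\in\mathcal{Y}$, there exists a measure $\mu_\theta(dx|y)$ on $\mathcal{X}$ such that $0<\mu_\theta(\mathcal{X}|y)<\infty$ and $$\varepsilon\,\mu_\theta(B|y)\le\int_B r_\theta(y,x'|x)\,\mu(dx')\le\frac{\mu_\theta(B|y)}{\varepsilon}$$ for all $x\in\mathcal{X}$, $B\in\mathcal{B}(\mathcal{X})$. (2) There exists a function $\psi:\mathcal{Y}\to[1,\infty)$ such that $|\partial_\theta^{\alpha}r_\theta(y,x'|x)|\le(\psi(y))^{|\alpha|}r_\theta(y,x'|x)$ for all $\theta\in\Theta$, $x,x'\in\mathcal{X}$, $y\in\mathcal{Y}$ and all $\alpha\in\mathbb{N}_0^d\setminus\{\mathbf{0}\}$ with $|\alpha|\le p$. Then there exist real numbers $\tau\in(0,1)$, $K\in[1,\infty)$ (depending only on $p$, $\varepsilon$) such that $$\|F_{\theta,\boldsymbol y}^{m:n}(\Lambda)\|\le K\|\Lambda\|^p\left(\sum_{k=m+1}^n\psi(y_k)\right)^p,$$ $$\|F_{\theta,\boldsymbol y}^{m:n}(\Lambda)-F_{\theta,\boldsymbol y}^{m:n}(\Lambda')\|\le K\tau^{n-m}\|\Lambda-\Lambda'\|(\|\Lambda\|+\|\Lambda'\|)^p\left(\sum_{k=m+1}^n\psi(y_k)\right)^p$$ for all $\theta\in\Theta$, $\Lambda,\Lambda'\in\mathcal{L}_0(\mathcal{X})$, $n\ge m\ge0$ and any sequence $\boldsymbol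 y=\{y_n\}_{n\ge1}$ in $\mathcal{Y}$, where for $n=m$ the sum $\sum_{k=m+1}^n\psi(y_k)$ is to be read as $1$.
   Context: Model. Integers $d,d_x,d_y,p\ge1$ are fixed; $\Theta\subset\mathbb{R}^d$ is a bounded open set; $\mathcal{X}\in\mathcal{B}(\mathbb{R}^{d_x})$, $\mathcal{Y}\in\mathcal{B}(\mathbb{R}^{d_y})$ ($\mathcal{B}(\cdot)$ denotes Borel sets); $\mu$, $\nu$ are measures on $\mathcal{X}$, $\mathcal{Y}$. $\mathcal{P}(\mathcal{X})$ is the set of probability measures and $\mathcal{M}_s(\mathcal{X})$ the set of finite signed measures on $\mathcal{X}$, with total variation norm $\|\cdot\|$. $p_\theta(x'|x)$ and $q_\theta(y|x)$ are $[0,\infty)$-valued functions of $\theta\in\Theta$, $x,x'\in\mathcal{X}$, $y\in\mathcal{Y}$ with $\int p_\theta(x'|x)\mu(dx')=\int q_\theta(y|x)\nu(dy)=1$, $p$-times differentiable in $\theta$; $r_\theta(y,x'|x)=q_\theta(y|x')p_\theta(x'|x)$. All integrands are tacitly Borel measurable. Multi-indices. For $\alpha,\beta\in\mathbb{N}_0^d$: $|\alpha|=\alpha_1+\cdots+\alpha_d$; $\beta\le\alpha$ means $\beta_i\le\alpha_i$ for all $i$; $\binom{\alpha}{\beta}=\prod_i\binom{\alpha_i}{\beta_i}$; $\partial_\theta^\alpha=\partial^{|\alpha|}/\partial\theta_1^{\alpha_1}\cdots\partial\theta_d^{\alpha_d}$; $\mathbf{0}$ is the zero multi-index. Vector measures.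 $\mathcal{L}_0(\mathcal{X})$ is the set of families $\Lambda=\{\lambda_\alpha:\alpha\in\mathbb{N}_0^d,|\alpha|\le p\}$ with $\lambda_\alpha\in\mathcal{M}_s(\mathcal{X})$ and $\lambda_{\mathbf{0}}\in\mathcal{P}(\mathcal{X})$; $\|\Lambda\|=\max_{|\alpha|\le p}\|\lambda_\alpha\|$, and $\Lambda-\Lambda'$, $\|\Lambda-\Lambda'\|$ are defined componentwise in the same way. Derivative maps. For $\lambda\in\mathcal{M}_s(\mathcal{X})$, $\Lambda\in\mathcal{L}_0(\mathcal{X})$, $|\alpha|\le p$: $$r_{\theta,y}^\alpha(x|\lambda)=\int\partial_\theta^\alpha r_\theta(y,x|x')\lambda(dx'),\qquad s_{\theta,y}^\alpha(x|\Lambda)=\sum_{\beta\le\alpha}\binom{\alpha}{\beta}\frac{r_{\theta,y}^{\alpha-\beta}(x|\lambda_\beta)}{\int r_{\theta,y}^{\mathbf{0}}(x'|\lambda_{\mathbf{0}})\mu(dx')},$$ and recursively in $|\alpha|$: $f_{\theta,y}^{\mathbf{0}}(x|\Lambda)=s_{\theta,y}^{\mathbf{0}}(x|\Lambda)$ and $$f_{\theta,y}^\alpha(x|\Lambda)=s_{\theta,y}^\alpha(x|\Lambda)-\sum_{\beta\le\alpha,\,\beta\ne\alpha}\binom{\alpha}{\beta}f_{\theta,y}^\beta(x|\Lambda)\int s_{\theta,y}^{\alpha-\beta}(x'|\Lambda)\mu(dx').$$ $F_{\theta,y}^\alpha(B|\Lambda)=\int_B f_{\theta,y}^\alpha(x|\Lambda)\mu(dx)$,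 $F_{\theta,y}(\Lambda)=\{F_{\theta,y}^\alpha(\cdot|\Lambda):|\alpha|\le p\}\in\mathcal{L}_0(\mathcal{X})$. For $n\ge m\ge0$ and a sequence $\boldsymbol y=\{y_n\}_{n\ge1}$ in $\mathcal{Y}$: $F_{\theta,\boldsymbol y}^{m:m}(\Lambda)=\Lambda$, $F_{\theta,\boldsymbol y}^{m:n+1}(\Lambda)=F_{\theta,y_{n+1}}(F_{\theta,\boldsymbol y}^{m:n}(\Lambda))$. *)

(* Defs.v *)
From HB Require Import structures.
From mathcomp Require Import all_boot all_order all_algebra.
From mathcomp Require Import all_classical all_reals all_analysis.
From mathcomp Require Import measurable_realfun.

Set Implicit Arguments.
Unset Strict Implicit.
Unset Printing Implicit Defensive.

Import Order.TTheory GRing.Theory Num.Theory.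
Import numFieldNormedType.Exports.

Local Open Scope classical_set_scope.
Local Open Scope ring_scope.

(* Multi-indices. Since every component of a multi-index of weight at most p
   is at most p, mindex d p is exactly {a in N^d : |a| <= p}; it is a finType. *)

Definition mindex (d p : nat) :=
  {a : {ffun 'I_d -> 'I_p.+1} | (\sum_(i < d) a i <= p)%N}.

Definition mindex_fun d p (a : mindex d p) (i : 'I_d) : nat := val a i.
Coercion mindex_fun : mindex >-> Funclass.

Section multiindex.
Context {d p : nat}.
Implicit Types a b : mindex d p.

Definition mabs a : nat := (\sum_(i < d) a i)%N.

Definition mle b a : bool := [forall i, (b i <= a i)%N].

Definition mbin a b : nat := (\prod_(i < d) 'C(a i, b i))%N.

Lemma mindex0_subproof :
  (\sum_(i < d) [ffun _ : 'I_d => ord0 : 'I_p.+1] i <= p)%N.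
Proof. by rewrite big1// => i _; rewrite ffunE. Qed.

Definition mindex0 : mindex d p := exist _ [ffun _ => ord0] mindex0_subproof.

Lemma msub_subproof a b :
  (\sum_(i < d) [ffun i => inord (a i - b i) : 'I_p.+1] i <= p)%N.
Proof.
apply: leq_trans (svalP a); apply: leq_sum => i _; rewrite ffunE inordK.
  exact: leq_subr.
by rewrite ltnS (leq_trans (leq_subr _ _))// -ltnS /mindex_fun.
Qed.

Definition msub a b : mindex d p := 
  exist _ [ffun i => inord (a i - b i)] (msub_subproof a b).

Lemma msubE a b i : msub a b i = (a i - b i)%N.
Proof.
rewrite /msub /mindex_fun/= ffunE inordK//.
by rewrite ltnS (leq_trans (leq_subr _ _))// -ltnS.
Qed.

Lemma mle_abs_lt a b : mle b a -> b != a -> (mabs b < mabs a)%N.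
Proof.
move=> /forallP ba; apply: contra_neqT; rewrite -leqNgt => ab.
have [_ abE] := leqif_sum (fun (i : 'I_d) (_ : true) => leqif_eq (ba i)).
apply/val_inj/ffunP => i; apply/val_inj/eqP => /=.
have : mabs b == mabs a.
  by rewrite eqn_leq ab andbT; apply: leq_sum => j _; exact: ba.
by rewrite abE => /forallP/(_ i).
Qed.

End multiindex.

Section derivatives.
Context {R : realType} {d : nat}.
Implicit Types (f : 'rV[R]_d -> R) (D : set 'rV[R]_d).

Definition pderiv (i : 'I_d) f : 'rV[R]_d -> R := 'D_(delta_mx 0 i) f.

(* d^|a| / (dtheta_1^(a 1) ... dtheta_d^(a d)), the innermost derivatives
   being those with respect to the last coordinate *)
Definition mderiv p (a : mindex d p) f : 'rV[R]_d -> R :=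
  foldr (fun i g => iter (a i) (pderiv i) g) f (enum 'I_d).

(* n-fold Frechet differentiability on the open set D: as R^d is
   finite-dimensional, the differential is n-1 times differentiable iff all
   the partial derivatives are. *)
Fixpoint ntimes_differentiable (n : nat) D f : Prop :=
  if n is n'.+1 then
    (forall theta, D theta -> differentiable f theta) /\
    (forall i, ntimes_differentiable n' D (pderiv i f))
  else True.

End derivatives.

(* A set with a chosen point, as the library's measurable types are pointed. *)
Definition pointed_set T (X : set T) (x0 : X) : Type := X.

HB.instance Definition _ (T : choiceType) (X : set T) (x0 : X) :=
  Choice.copy (pointed_set x0) X.
HB.instance Definition _ (T : choiceType) (X : set T) (x0 : X) :=
  isPointed.Build (pointed_set x0) x0.

(* X with the sigma-algebra {X `&` B : B Borel set of R^n} *)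
Definition borel_sub {R : realType} n (X : set 'rV[R]_n) (x0 : X) :
    measurableType _ :=
  g_sigma_algebra_preimageType
    (val : pointed_set x0 -> g_sigma_algebraType (@open 'rV[R]_n)).

Section signed_measures.
Context {disp : measure_display} {T : measurableType disp} {R : realType}.
Implicit Types lam : {charge set T -> \bar R}.

(* A chosen Hahn decomposition; the Jordan decomposition, hence tvnorm and
   cintegral below, do not depend on the choice. *)
Definition hahn_pos lam : set T := sval (cid (Hahn_decomposition lam)).

Definition hahn_neg lam : set T :=
  sval (cid (svalP (cid (Hahn_decomposition lam)))).

Definition hahn_posneg lam :
    hahn_decomposition lam (hahn_pos lam) (hahn_neg lam) :=
  svalP (cid (svalP (cid (Hahn_decomposition lam)))).

Definition tvnorm lam : R := fine (charge_variation (hahn_posneg lam) setT).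

Definition cintegral lam (f : T -> R) : R :=
  \int[jordan_pos (hahn_posneg lam)]_x f x -
  \int[jordan_neg (hahn_posneg lam)]_x f x.

Definition csub lam lam' : {charge set T -> \bar R} := cadd lam (copp lam').

(* The signed measure f dmu; junk value 0 if f is not mu-integrable. *)
Definition density_charge (mu : {measure set T -> \bar R}) (f : T -> R) :
    {charge set T -> \bar R} :=
  match pselect (mu.-integrable setT (EFin \o f)) with
  | left intf => induced_charge intf
  | right _ => czero
  end.

End signed_measures.

Section vector_measures.
Context {disp : measure_display} {T : measurableType disp} {R : realType}.
Context {d p : nat}.

Definition vmeas := mindex d p -> {charge set T -> \bar R}.

Implicit Types Lam : vmeas.

Definition isL0 Lam : Prop :=
  (forall B, measurable B -> 0 <= Lam mindex0 B)%E /\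
  Lam mindex0 setT = 1%E.

Definition vnorm Lam : R :=
  \big[Num.max/0]_(a : mindex d p) tvnorm (Lam a).

Definition vsub Lam Lam' : vmeas := fun a => csub (Lam a) (Lam' a).

End vector_measures.

Arguments vmeas {disp} T R d p.

Section filter_derivatives.
Context {disp : measure_display} {X : measurableType disp} {R : realType}.
Context {d p : nat} {Y : Type}.
Variable mu : {measure set X -> \bar R}.
(* r theta y x' x stands for r_theta(y, x' | x) *)
Variable r : 'rV[R]_d -> Y -> X -> X -> R.
Implicit Types (theta : 'rV[R]_d) (y : Y) (a b : mindex d p).
Implicit Types (Lam : vmeas X R d p).

Definition dr theta y a (x' x : X) : R :=
  mderiv a (fun t => r t y x' x) theta.

Definition rdens theta y a (x : X) (lam : {charge set X -> \bar R}) : R :=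
  cintegral lam (dr theta y a x).

Definition sdens theta y a (x : X) Lam : R :=
  \sum_(b : mindex d p | mle b a) (mbin a b)%:R *
    (rdens theta y (msub a b) x (Lam b) /
     \int[mu]_x' rdens theta y mindex0 x' (Lam mindex0)).

(* The recursion on |a|, with n as a bound on the recursion depth; see fdensE. *)
Fixpoint fdens_rec (n : nat) theta y a (x : X) Lam : R :=
  sdens theta y a x Lam -
  (if n is n'.+1 then
     \sum_(b : mindex d p | mle b a && (b != a)) (mbin a b)%:R *
       fdens_rec n' theta y b x Lam *
       \int[mu]_x' sdens theta y (msub a b) x' Lam
   else 0).

Definition fdens theta y a x Lam : R := fdens_rec (mabs a) theta y a x Lam.

Lemma fdens_rec_fuel n theta y a x Lam : (mabs a <= n)%N ->
  fdens_rec n theta y a x Lam = fdens theta y a x Lam.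
Proof.
have [m] := ubnP (mabs a); rewrite /fdens.
elim: m a n => // m ih a n; rewrite ltnS => am an.
have lt_a b : mle b a && (b != a) -> (mabs b < mabs a)%N.
  by move=> /andP[]; exact: mle_abs_lt.
case: n an => [|n] an; first by move: an; rewrite leqn0 => /eqP ->.
case: (mabs a) am an lt_a => [|k] am an lt_a /=; congr (_ - _).
  by rewrite big1// => b /lt_a.
apply: eq_bigr => b /lt_a bk; have bm := leq_trans bk am.
have bn : (mabs b <= n)%N by exact: leq_trans bk an.
by rewrite (ih b n)// (ih b k).
Qed.

Lemma fdensE theta y a x Lam :
  fdens theta y a x Lam = sdens theta y a x Lam -
    \sum_(b : mindex d p | mle b a && (b != a)) (mbin a b)%:R *
      fdens theta y b x Lam * \int[mu]_x' sdens theta y (msub a b) x' Lam.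
Proof.
rewrite -(fdens_rec_fuel _ _ _ _ (leqnSn (mabs a)))/=; congr (_ - _).
apply: eq_bigr => b /andP[ba nba].
by rewrite fdens_rec_fuel// ltnW// mle_abs_lt.
Qed.

Definition Fstep theta y Lam : vmeas X R d p :=
  fun a => density_charge mu (fun x => fdens theta y a x Lam).

(* F^{m:n}, meaningful for m <= n; the observation y_k is ys k, k >= 1. *)
Fixpoint Fiter theta (ys : nat -> Y) (m n : nat) Lam : vmeas X R d p :=
  if n is n'.+1 then
    if (m <= n')%N then Fstep theta (ys n) (Fiter theta ys m n' Lam) else Lam
  else Lam.

Lemma Fiter_start theta ys m Lam : Fiter theta ys m m Lam = Lam.
Proof. by case: m => //= m; rewrite ltnn. Qed.

Lemma Fiter_step theta ys m n Lam : (m <= n)%N ->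
  Fiter theta ys m n.+1 Lam = Fstep theta (ys n.+1) (Fiter theta ys m n Lam).
Proof. by move=> /= ->. Qed.

(* Finiteness of the normalizing constants of F_{theta,y} on L_0(X), without
   which F_{theta,y}(Lambda) is undefined. It is automatic when mu is
   sigma-finite, see sigma_finite_normalizable, but not for arbitrary mu. *)
Definition normalizable (D : set 'rV[R]_d) : Prop :=
  forall theta y (lam : probability X R), D theta ->
    (\int[mu]_x' \int[lam]_x (r theta y x' x)%:E < +oo)%E.

Lemma sigma_finite_normalizable (D : set 'rV[R]_d) :
  sigma_finite setT mu ->
  (forall theta y x' x, D theta -> 0 <= r theta y x' x) ->
  (forall theta y, D theta ->
     measurable_fun setT (fun z : X * X => r theta y z.1 z.2)) ->
  (forall theta y, D theta -> exists C : R,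
     forall x, (\int[mu]_x' (r theta y x' x)%:E <= C%:E)%E) ->
  normalizable D.
Proof.
move=> smu r0 mr bnd theta y lam Dtheta.
have [C rC] := bnd theta y Dtheta.
pose sf := @isSFinite.Build _ _ _ mu (sfinite_measure_sigma_finite smu).
pose sgf := @isSigmaFinite.Build _ _ _ mu smu.
pose m : sigma_finite_measure X R := HB.pack (Measure.sort mu) sf sgf.
have mf : measurable_fun setT (fun z : X * X => (r theta y z.1 z.2)%:E).
  by apply/measurable_EFinP; exact: mr.
have f0 (z : X * X) : (0 <= (r theta y z.1 z.2)%:E)%E by rewrite lee_fin r0.
rewrite [ltLHS](@fubini_tonelli _ _ _ _ _ m lam _ mf f0).
apply: (@le_lt_trans _ _ (\int[lam]_x (cst C%:E x)))%E.
  apply: ge0_le_integral => //=.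
  - by move=> x _; apply: integral_ge0 => x' _; exact: (f0 (x', x)).
  - exact: (@measurable_fun_fubini_tonelli_G _ _ _ _ _ m _ mf f0).
by rewrite integral_cst //= probability_setT mule1 ltry.
Qed.

End filter_derivatives.

Definition psi_sum {R : realType} {Y : Type} (psi : Y -> R) (ys : nat -> Y)
    (m n : nat) : R :=
  if n == m then 1 else \sum_(m.+1 <= k < n.+1) psi (ys k).

(* Main.v *)
Require Import Defs.
From HB Require Import structures.
From mathcomp Require Import all_boot all_order all_algebra.
From mathcomp Require Import all_classical all_reals all_analysis.
From mathcomp Require Import measurable_realfun.
From mathcomp Require Import ring lra zify.

Set Implicit Arguments.
Unset Strict Implicit.
Unset Printing Implicit Defensive.

Import Order.TTheory GRing.Theory Num.Theory.
Import numFieldNormedType.Exports.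

Local Open Scope classical_set_scope.
Local Open Scope ring_scope.

(** Fix the parameter and put the derivatives of order [a] of all objects
    together as the coefficients of power series in [t_1, ..., t_d],
    truncated at order [p], with the weights [t^a / a!]. A vector measure
    [Lam] is then one measure-valued series, the derivatives of [r] at an
    observation [y] are one series [R_y] of kernels, and the Leibniz sums in
    the definitions of [s] and [f] are products. The recursion that defines
    [f] says that the update is a quotient: it multiplies [Lam] by [R_y] and
    divides by the total mass, a scalar series ([Fstep_quotient]). The
    intermediate normalisations cancel, so that, with [Q] the product of the
    [R_y] over the observations [y_(m+1), ..., y_n], the iterated update
    integrates a bounded function [g] to the quotient of [Lam (Q g)] by [Lam
    (Q 1)] ([iter_step_quotient]). The total variation norm is the supremum
    of such integrals over [|g| <= 1] ([tvnorm_le]), hence only functions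
    have to be estimated.

    Growth. The domination of the derivatives of [r] says that [R_y] is
    dominated, coefficient by coefficient, by its term of order [0] times the
    series [exp (psi y (t_1 + ... + t_d))]. This property is multiplicative,
    so [Q g] is dominated by [Q_0 1] times [exp (Psi (t_1 + ... + t_d))],
    with [Psi] the sum of the [psi y] ([bwd_bound]). Since [Q_0 1] varies by
    a bounded factor only, a division of power series ([quotient_bound])
    yields the first estimate, with one factor [Psi] and one factor [vnorm
    Lam] per order of differentiation.

    Stability. Let [w] be the series of functions [Q g / Q 1]. When one more
    kernel is applied, [w] is transformed by a series of operators that
    preserve constants, whose term of order [0] is a Markov operator with a
    minorisation. The latter contracts oscillations ([doeblin]); the other
    terms, which feed an order from the strictly smaller ones, are made
    negligible by weighting the order [a] by [B ^ |a|] with [B] large. Thus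
    all coefficients of [w] oscillate by at most a constant times [tau ^ (n -
    m) (B Psi) ^ |a|] ([ratio_osc]). If [w] were equal to a constant series
    [c], the quotient would be [c] for every [Lam]; the difference of the
    quotients for [Lam] and [Lam'] is controlled by [Lam - Lam'] and [w - c]
    ([iter_step_stability]).

    All sums over multi-indices carry binomial weights of total mass [2 ^
    |a|], so that the constants depend on [p] and [eps] only.

    The exchange of integrals behind the duality, which says that the
    transposed kernel acts on [g], cannot rely on [mu] being sigma-finite;
    see [kernel_fubini]. *)

(** * Truncated power series in several variables *)

Section mindex_theory.
Context {d p : nat}.
Implicit Types a b c : mindex d p.

Lemma mleP b a : reflect (forall i, (b i <= a i)%N) (mle b a).
Proof. exact: forallP. Qed.

Lemma mindexP a b : (forall i, a i = b i) -> a = b.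
Proof. by move=> ab; apply/val_inj/ffunP => i; apply/val_inj/ab. Qed.

Lemma mindex0E i : (mindex0 : mindex d p) i = 0%N.
Proof. by rewrite /mindex_fun /= ffunE. Qed.

Lemma mle0 a : mle mindex0 a.
Proof. by apply/mleP => i; rewrite mindex0E. Qed.

Lemma mlexx a : mle a a. Proof. exact/mleP. Qed.

Lemma mle_msub a b : mle (msub a b) a.
Proof. by apply/mleP => i; rewrite msubE leq_subr. Qed.

Lemma msubK a b : mle b a -> msub a (msub a b) = b.
Proof. by move=> /mleP ba; apply: mindexP => i; rewrite !msubE subKn. Qed.

Lemma msub0 a : msub a mindex0 = a.
Proof. by apply: mindexP => i; rewrite msubE mindex0E subn0. Qed.

Lemma msubaa a : msub a a = mindex0.
Proof. by apply: mindexP => i; rewrite msubE mindex0E subnn. Qed.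

Lemma msub_eq0 a b : mle b a -> (msub a b == mindex0) = (b == a).
Proof.
move=> ba; apply/eqP/eqP => [ab|->]; last exact: msubaa.
by rewrite -(msubK ba) ab msub0.
Qed.

Lemma mabs0 : mabs (mindex0 : mindex d p) = 0%N.
Proof. by rewrite /mabs big1// => i _; rewrite mindex0E. Qed.

Lemma mabs_gt0 a : a != mindex0 -> (0 < mabs a)%N.
Proof.
by rewrite eq_sym => a0; have := mle_abs_lt (mle0 a) a0; rewrite mabs0.
Qed.

Lemma mabs_le a : (mabs a <= p)%N. Proof. exact: (svalP a). Qed.

Lemma mbinaa a : mbin a a = 1%N.
Proof. by rewrite /mbin big1// => i _; rewrite binn. Qed.

Lemma mbin_sub a b : mle b a -> mbin a (msub a b) = mbin a b.
Proof.
by move=> /mleP ba; apply: eq_bigr => i _; rewrite msubE bin_sub.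
Qed.

Lemma bin_swap n i j : (i + j <= n)%N ->
  ('C(n, i) * 'C(n - i, j) = 'C(n, j) * 'C(n - j, i))%N.
Proof.
move=> ijn; have ij : (i <= n)%N by lia. have ji : (j <= n)%N by lia.
have e1 := bin_fact ij; have e2 := bin_fact ji.
have /bin_fact e3 : (j <= n - i)%N by lia.
have /bin_fact e4 : (i <= n - j)%N by lia.
have f0 : (0 < i`! * (j`! * (n - i - j)`!))%N by rewrite !muln_gt0 !fact_gt0.
apply/eqP; rewrite -(eqn_pmul2r f0); apply/eqP.
transitivity n`!; [rewrite -e1 -e3|rewrite -e2 -e4 (subnAC n j i)]; ring.
Qed.

Lemma mle_msubC a b c :
  mle b a && mle c (msub a b) = mle c a && mle b (msub a c).
Proof.
have imp x y : mle x a && mle y (msub a x) -> mle y a && mle x (msub a y).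
  move=> /andP[/mleP xa /mleP ya]; apply/andP; split; apply/mleP => i;
  by have := xa i; have := ya i; rewrite !msubE; lia.
by apply/idP/idP; exact: imp.
Qed.

Lemma mbin_swap a b c : mle b a -> mle c (msub a b) ->
  (mbin a b * mbin (msub a b) c = mbin a c * mbin (msub a c) b)%N.
Proof.
move=> /mleP ba /mleP ca; rewrite /mbin -!big_split/=.
apply: eq_bigr => i _; rewrite !msubE bin_swap//.
by have := ba i; have := ca i; rewrite msubE; lia.
Qed.

End mindex_theory.

Section bsum.
Context {R : realType} {d p : nat}.
Implicit Types (a b c : mindex d p) (T : mindex d p -> mindex d p -> R).

(** The Leibniz sum: if [T b c] is bilinear in the Taylor coefficients of order
    [b] and [c] of two objects, then [bsum T a] is the coefficient of order [a]
    of their product. The products of scalars, of functions, of operators and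
    functions, and of measures and functions are all of this form. *)
Definition bsum T a : R :=
  \sum_(b | mle b a) (mbin a b)%:R * T b (msub a b).

(** All the terms of [bsum T a] but the one in which the first factor has the
    full order [a], which is the unknown when a power series is divided. *)
Definition bsum_lt T a : R :=
  \sum_(b | mle b a && (b != a)) (mbin a b)%:R * T b (msub a b).

Definition psmul (u v : mindex d p -> R) a : R := bsum (fun b c => u b * v c) a.

Lemma eq_bsum T T' a : (forall b c, T b c = T' b c) -> bsum T a = bsum T' a.
Proof. by move=> TT; apply: eq_bigr => b _; rewrite TT. Qed.

Lemma bsumC T a : bsum T a = bsum (fun b c => T c b) a.
Proof.
rewrite /bsum (reindex_onto (msub a) (msub a)) /=; last first.
  by move=> b ba; rewrite msubK.
apply: eq_big => [b|b /andP[_ /eqP bE]]; last first.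
  by rewrite bE mbin_sub// -bE mle_msub.
rewrite mle_msub/=; apply/eqP/idP => [<-|]; [exact: mle_msub|exact: msubK].
Qed.

(** Associativity of the product, in trilinear form. After exchanging the two
    factors of a product the exchange of sums is over pairs [b], [c] with
    [b + c <= a], a condition that is symmetric, as is the weight. *)
Lemma bsumA (T : mindex d p -> mindex d p -> mindex d p -> R) a :
  bsum (fun b e => bsum (fun c c' => T c c' e) b) a =
  bsum (fun c g => bsum (fun c' e => T c c' e) g) a.
Proof.
rewrite bsumC; under [RHS]eq_bsum do rewrite bsumC.
rewrite /bsum; under eq_bigr do rewrite mulr_sumr.
under [RHS]eq_bigr do rewrite mulr_sumr.
rewrite (exchange_big_dep predT)//= [RHS]big_mkcond/=.
apply: eq_bigr => c _; case: ifPn => ca; last first.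
  rewrite big_pred0// => b; rewrite mle_msubC (negbTE ca)//.
rewrite (eq_bigl (mle^~ (msub a c))); last first.
  by move=> b; rewrite mle_msubC ca.
apply: eq_bigr => b bac; have [ba cab] : mle b a /\ mle c (msub a b).
  by apply/andP; rewrite mle_msubC ca.
rewrite !mulrA -!natrM mbin_swap//; congr (_ * T c _ b).
by apply: mindexP => i; rewrite !msubE subnAC.
Qed.

Lemma bsumE T a : bsum T a = bsum_lt T a + T a mindex0.
Proof.
rewrite /bsum /bsum_lt (bigD1 a) ?mlexx//= addrC mbinaa mul1r msubaa.
by congr (_ + _); apply: eq_bigl => b.
Qed.

Lemma bsum0 T : bsum T mindex0 = T mindex0 mindex0.
Proof.
rewrite bsumE [bsum_lt _ _]big1 ?add0r// => b /andP[b0 nb0].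
by have := mle_abs_lt b0 nb0; rewrite mabs0.
Qed.

Lemma bsum_lin T T' (k : R) a :
  bsum (fun b c => T b c + k * T' b c) a = bsum T a + k * bsum T' a.
Proof.
by rewrite /bsum mulr_sumr -big_split/=; apply: eq_bigr => b _; ring.
Qed.

Lemma bsumZ T (k : R) a : bsum (fun b c => k * T b c) a = k * bsum T a.
Proof. by rewrite /bsum mulr_sumr; apply: eq_bigr => b _; ring. Qed.

Lemma bsumB T T' a :
  bsum (fun b c => T b c - T' b c) a = bsum T a - bsum T' a.
Proof.
by rewrite -mulN1r -bsum_lin; apply: eq_bsum => b c; rewrite mulN1r.
Qed.

Lemma bsum_le_norm T T' a : (forall b c, `|T b c| <= T' b c) ->
  `|bsum T a| <= bsum T' a.
Proof.
move=> TT; apply: (le_trans (ler_norm_sum _ _ _)); apply: ler_sum => b _.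
by rewrite normrM ger0_norm ?ler_wpM2l.
Qed.

Lemma bsum_lt_le_norm T T' a :
  (forall b c, (mabs b < mabs a)%N -> c != mindex0 -> `|T b c| <= T' b c) ->
  `|bsum_lt T a| <= bsum_lt T' a.
Proof.
move=> TT; apply: (le_trans (ler_norm_sum _ _ _)).
apply: ler_sum => b /andP[ba nba].
rewrite normrM ger0_norm ?ler_wpM2l// TT ?mle_abs_lt//.
by rewrite msub_eq0.
Qed.

(** The two sides are the coefficients of order [a] of the product of
    [exp (x (t_1 + ... + t_d))] and [exp (y (t_1 + ... + t_d))]. The total
    mass [2 ^ |a|] of the binomial weights does not involve the number [d]
    of variables, which is why the final constants do not either. *)
Lemma bsum_pow (x y : R) a :
  bsum (fun b c => x ^+ mabs b * y ^+ mabs c) a = (x + y) ^+ mabs a.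
Proof.
pose F i j := 'C(a i, j)%:R * (x ^+ j * y ^+ (a i - j)) : R.
have xyE i : (x + y) ^+ a i = \sum_(j < p.+1) F i j.
  (* the terms beyond [a i] vanish with the binomial coefficient, so that every
     factor is a sum over the same index type *)
  rewrite addrC exprDn (@big_ord_widen _ _ _ _ p.+1 (fun j =>
    (y ^+ (a i - j) * x ^+ j) *+ 'C(a i, j))) ?ltn_ord//.
  rewrite big_mkcond/=; apply: eq_bigr => j _; rewrite /F.
  case: ifPn => [_|]; first by rewrite -[LHS]mulr_natl (mulrC (y ^+ _)).
  by rewrite -leqNgt => aj; rewrite bin_small// mul0r.
rewrite [in RHS]/mabs -prodrXr (eq_bigr _ (fun i _ => xyE i)).
rewrite (bigA_distr_bigA (fun i (j : 'I_p.+1) => F i j)).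
rewrite (bigID [pred f : {ffun 'I_d -> 'I_p.+1} |
  [forall i, (f i <= a i)%N]])/= [X in _ = _ + X]big1 ?addr0; last first.
  move=> f; rewrite negb_forall => /existsP[i]; rewrite -ltnNge => ai.
  by rewrite (bigD1 i)//= /F bin_small// mul0r mul0r.
rewrite (reindex_omap (val : mindex d p -> _) insub)/=; last first.
  move=> f /forallP fa; rewrite insubT//.
  by apply: leq_trans (svalP a); exact: leq_sum.
apply: eq_big => [b|b _].
  by rewrite valK eqxx andbT.
rewrite /F !big_split/= /mabs -!prodrXr natr_prod.
by congr (_ * (_ * _)); apply: eq_bigr => i _; rewrite ?msubE.
Qed.

Lemma bsum_lt_pow (x y : R) a :
  bsum_lt (fun b c => x ^+ mabs b * y ^+ mabs c) a =
  (x + y) ^+ mabs a - x ^+ mabs a.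
Proof. by rewrite -bsum_pow bsumE mabs0 expr0 mulr1 addrK. Qed.

Lemma psmulC u v a : psmul u v a = psmul v u a.
Proof. by rewrite /psmul bsumC; apply: eq_bsum => b c; rewrite mulrC. Qed.

Lemma psmulA u v w a : psmul (psmul u v) w a = psmul u (psmul v w) a.
Proof.
rewrite /psmul.
under eq_bsum do rewrite mulrC -bsumZ.
under [RHS]eq_bsum do rewrite -bsumZ.
rewrite bsumA; apply: eq_bsum => b c; apply: eq_bsum => e f; ring.
Qed.

Lemma eq_psmul u u' v v' a : u =1 u' -> v =1 v' -> psmul u v a = psmul u' v' a.
Proof. by move=> uu vv; apply: eq_bsum => b c; rewrite uu vv. Qed.

Lemma psmulE u v a :
  psmul u v a = bsum_lt (fun b c => u b * v c) a + u a * v mindex0.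
Proof. exact: bsumE. Qed.

Lemma expr_add_le (x y : R) n : 0 <= y <= x ->
  (y + x) ^+ n.+1 <= x ^+ n.+1 + 2 ^+ n.+1 * y * x ^+ n.
Proof.
move=> /andP[y0 yx]; have x0 : 0 <= x by exact: le_trans yx.
suff : (y + x) ^+ n.+1 <= x ^+ n.+1 + (2 ^+ n.+1 - 1) * y * x ^+ n.
  move/le_trans; apply; rewrite lerD2l ler_wpM2r ?exprn_ge0// ler_wpM2r//.
  by rewrite gerBl.
elim: n => [|n ih]; first by rewrite !expr1 expr0; nra.
rewrite exprS (le_trans (ler_wpM2l _ ih)) ?addr_ge0//.
have e1 : 1 <= 2 ^+ n.+1 :> R by rewrite exprn_ege1// ler1n.
rewrite -subr_ge0 (_ : _ - _ =
   (2 ^+ n.+1 - 1) * y * x ^+ n * (x - y)); last by rewrite !exprS; ring.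
by rewrite !mulr_ge0 ?exprn_ge0 ?subr_ge0.
Qed.

(** Division by a power series [b] whose coefficients grow at most like
    [M ^ |a|] costs a geometric factor only: solving the triangular system for
    [u] order by order, the terms of lower order contribute at most half of
    the announced bound as soon as [N] dominates [k 2^p M]. *)
Lemma quotient_bound (u b c : mindex d p -> R) (t k M N : R) :
  psmul u b =1 c -> 0 < b mindex0 -> 0 <= t -> 0 <= k -> 0 <= M ->
  M <= N -> k * 2 ^+ p * M <= N ->
  (forall a, `|c a| <= t * N ^+ mabs a * b mindex0) ->
  (forall a, a != mindex0 -> `|b a| <= k * M ^+ mabs a * b mindex0) ->
  forall a, `|u a| <= t * (2 * N) ^+ mabs a.
Proof.
move=> uvc b0 t0 k0 M0 MN kMN cN bM a.
have N0 : 0 <= N by exact: le_trans MN.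
have [n] := ubnP (mabs a); elim: n a => // n ih a an.
have [->|a0] := eqVneq a mindex0.
  rewrite mabs0 expr0 mulr1; have := cN mindex0.
  rewrite -uvc /psmul bsum0 normrM mabs0 expr0 mulr1 (gtr0_norm b0).
  by rewrite ler_pM2r.
have uE : u a * b mindex0 = c a - bsum_lt (fun e f => u e * b f) a.
  by rewrite -uvc psmulE addrC addKr.
rewrite -(ler_pM2r b0) -{1}(gtr0_norm b0) -normrM uE.
apply: (le_trans (ler_normB _ _)).
have lt_le : `|bsum_lt (fun e f => u e * b f) a| <=
    t * k * ((2 * N + M) ^+ mabs a - (2 * N) ^+ mabs a) * b mindex0.
  rewrite -bsum_lt_pow {2}/bsum_lt mulr_sumr mulr_suml.
  apply: (@le_trans _ _ (bsum_lt (fun e f =>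
      t * (2 * N) ^+ mabs e * (k * M ^+ mabs f * b mindex0)) a)).
    apply: bsum_lt_le_norm => e f ea f0; rewrite normrM ler_pM// ?bM// ih//.
    by rewrite (leq_trans ea).
  by rewrite /bsum_lt; apply: ler_sum => e _; rewrite le_eqVlt; apply/orP;
    left; apply/eqP; ring.
apply: (le_trans (lerD (cN a) lt_le)); rewrite -mulrDl ler_pM2r// -mulrA.
rewrite -mulrDr ler_wpM2l//.
have := mabs_gt0 a0; have := mabs_le a; case: (mabs a) => // j jp _.
have H := @expr_add_le (2 * N) M j; rewrite addrC in H.
have {H} : (2 * N + M) ^+ j.+1 - (2 * N) ^+ j.+1 <=
    2 ^+ j.+1 * M * (2 * N) ^+ j.
  by rewrite lerBlDl H//; apply/andP; split=> //; lra.
move/(ler_wpM2l k0) => H; apply: (le_trans (lerD (lexx _) H)).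
rewrite (_ : k * _ = (k * 2 ^+ j.+1 * M) * (2 * N) ^+ j); last by ring.
apply: (@le_trans _ _ (N * (2 * N) ^+ j + N * (2 * N) ^+ j)); last first.
  by rewrite -mulrDl exprS le_eqVlt; apply/orP; left; apply/eqP; ring.
apply: lerD.
  rewrite exprS ler_wpM2l// lerXn2r ?nnegrE//; lra.
rewrite ler_wpM2r ?exprn_ge0 ?mulr_ge0// (le_trans _ kMN)//.
by rewrite ler_wpM2r// ler_wpM2l// ler_weXn2l// ler1n.
Qed.

End bsum.

(** * Bounded measurable test functions and signed measures *)

Section test_functions.
Context {disp : measure_display} {T : measurableType disp} {R : realType}.
Implicit Types f g : T -> R.

Definition bmeas f :=
  measurable_fun setT f /\ exists C : R, forall x, `|f x| <= C.

Lemma bmeas_cst (k : R) : bmeas (fun=> k).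
Proof. by split; [exact: measurable_cst|exists `|k|]. Qed.

Lemma bmeasD f g : bmeas f -> bmeas g -> bmeas (fun x => f x + g x).
Proof.
move=> [mf [C fC]] [mg [D gD]]; split; first exact: measurable_funD.
by exists (C + D) => x; rewrite (le_trans (ler_normD _ _))// lerD.
Qed.

Lemma bmeasM f g : bmeas f -> bmeas g -> bmeas (fun x => f x * g x).
Proof.
move=> [mf [C fC]] [mg [D gD]]; split; first exact: measurable_funM.
by exists (C * D) => x; rewrite normrM ler_pM.
Qed.

Lemma bmeasZ (k : R) f : bmeas f -> bmeas (fun x => k * f x).
Proof. by apply: bmeasM; exact: bmeas_cst. Qed.

Lemma bmeasB f g : bmeas f -> bmeas g -> bmeas (fun x => f x - g x).
Proof.
move=> bf bg; under eq_fun do rewrite -mulN1r.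
by apply: bmeasD => //; exact: bmeasZ.
Qed.

Lemma bmeas_lin f g (k : R) : bmeas f -> bmeas g ->
  bmeas (fun x => f x + k * g x).
Proof. by move=> bf bg; apply: bmeasD => //; exact: bmeasZ. Qed.

Lemma bmeas_norm f : bmeas f -> bmeas (fun x => `|f x|).
Proof.
move=> [mf [C fC]]; split; first exact: measurableT_comp.
by exists C => x; rewrite normr_id.
Qed.

Lemma bmeas_sum (I : finType) (P : pred I) (F : I -> T -> R) :
  (forall i, P i -> bmeas (F i)) -> bmeas (fun x => \sum_(i | P i) F i x).
Proof.
move=> bF; suff H (s : seq I) : bmeas (fun x => \sum_(i <- s | P i) F i x).
  exact: H.
elim: s => [|i s ih].
  by under eq_fun do rewrite big_nil; exact: bmeas_cst.
case Pi : (P i); under eq_fun do rewrite big_cons Pi; last exact: ih.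
by apply: bmeasD => //; exact: bF.
Qed.

Lemma bmeas_indic (A : set T) : measurable A -> bmeas (\1_A : T -> R).
Proof.
move=> mA; split; first exact: measurable_indic.
exists 1 => x; rewrite indicE; case: (_ \in _); rewrite ?normr1// normr0//.
Qed.

Lemma bmeas_divr f g (k : R) : bmeas f -> bmeas g -> 0 < k ->
  (forall x, k <= g x) -> bmeas (fun x => f x / g x).
Proof.
move=> bf [mg _] k0 kg; apply: bmeasM => //; split.
  rewrite (_ : (fun x => _) = (@powR R)^~ (-1) \o g).
    by apply: measurableT_comp mg; exact: measurable_powR.
  apply/funext => x /=; rewrite powR_inv1//.
  by rewrite (le_trans _ (kg x))// ltW.
exists k^-1 => x.
have gx : 0 < g x by exact: lt_le_trans (kg x).
by rewrite gtr0_norm ?invr_gt0// lef_pV2.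
Qed.

(** A functional that is linear and bounded for the supremum norm is determined
    by the measures of sets: [g] with values in [[0, C]] is within [C / n] of
    the layer sum [C / n * \sum_(i < n) 1_{g > C i / n}]. *)
Lemma bmeas_functional_eq0 (Phi : (T -> R) -> R) (B : R) :
  (forall f g k, bmeas f -> bmeas g ->
     Phi (fun x => f x + k * g x) = Phi f + k * Phi g) ->
  (forall f (C : R), bmeas f -> (forall x, `|f x| <= C) -> `|Phi f| <= B * C) ->
  (forall A, measurable A -> Phi \1_A = 0) ->
  forall f, bmeas f -> Phi f = 0.
Proof.
move=> lin bnd ind f bf.
have Phi0 : Phi (fun=> 0) = 0.
  by have := ind _ (@measurable0 _ T); rewrite indic0.
have Phicst k : Phi (fun=> k) = 0.
  have := lin (fun=> 0) \1_setT k (bmeas_cst _) (bmeas_indic measurableT).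
  rewrite Phi0 ind// mulr0 addr0 => <-; congr Phi; apply/funext => x.
  by rewrite indicT mulr1 add0r.
have [mf [C fC]] := bf.
have C0 : 0 <= C by exact: le_trans (fC point).
(* [f + C] takes its values in [[0, 2 C]]; the extra [1] keeps [D] positive *)
pose D := 2 * C + 1; have D0 : 0 < D by rewrite /D; lra.
suff H n : (0 < n)%N -> `|Phi f| <= B * (D / n%:R).
  apply/eqP; rewrite -normr_eq0 eq_le normr_ge0 andbT leNgt; apply/negP => f0.
  have /archi_boundP : 0 <= `|B * D| / `|Phi f| by rewrite divr_ge0.
  set n := Num.bound _ => nB; have n0 : (0 < n)%N.
    by rewrite -(ltr0n R); apply: le_lt_trans nB; rewrite divr_ge0.
  have := H n n0; rewrite mulrA ler_pdivlMr ?ltr0n// => H1.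
  move: nB; rewrite ltr_pdivrMr//; have := ler_norm (B * D); lra.
move=> n0; have nR : 0 < n%:R :> R by rewrite ltr0n.
pose A i := [set x | i%:R * (D / n%:R) < f x + C].
have mA i : measurable (A i).
  rewrite (_ : A i = setT `&` f @^-1` `]i%:R * (D / n%:R) - C, +oo[%classic).
    exact: mf.
  by rewrite setTI; apply/funext => x; rewrite /A/= in_itv/= andbT ltrBlDr.
pose s m x := \sum_(i < m) (\1_(A i) x : R).
have bs m : bmeas (s m) by apply: bmeas_sum => i _; exact: bmeas_indic.
have Phis m : Phi (s m) = 0.
  elim: m => [|m ih]; first by rewrite /s; under eq_fun do rewrite big_ord0.
  rewrite (_ : s m.+1 = fun x => s m x + 1 * (\1_(A m) x : R)).
    by rewrite lin ?ih ?ind ?mulr0 ?addr0//; exact: bmeas_indic.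
  by apply/funext => x; rewrite /s big_ord_recr/= mul1r.
have count m (t : R) : 0 <= t <= m%:R ->
    t <= \sum_(i < m) ((i%:R : R) < t)%R%:R <= t + 1.
  elim: m => [|m ih] /andP[t0 tm]; first by rewrite big_ord0; lra.
  rewrite big_ord_recr/=; have [mt|tm'] := ltP m%:R t.
    rewrite (eq_bigr (fun=> 1)) ?sumr_const ?card_ord.
      by rewrite -(natr1 m) in tm; rewrite /= mulr1n; lra.
    by move=> i _; rewrite (lt_trans _ mt)// ltr_nat.
  by rewrite addr0 ih// t0.
pose h x := f x + 1 * C; have bh : bmeas h.
  by apply: (bmeas_lin 1 bf); exact: bmeas_cst.
have -> : Phi f = Phi (fun x => h x + - (D / n%:R) * s n x).
  rewrite lin// Phis mulr0 addr0 /h lin ?Phicst ?mulr0 ?addr0//.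
  exact: bmeas_cst.
apply: bnd => [|x]; first exact: bmeas_lin.
have Dn : 0 < D / n%:R by rewrite divr_gt0.
have : 0 <= h x / (D / n%:R) <= n%:R.
  have := fC x; rewrite ler_norml => /andP[f1 f2].
  rewrite divr_ge0 ?(ltW Dn) /h ?mul1r//=; last by lra.
  rewrite ler_pdivrMr// mulrCA divff ?gt_eqF// mulr1 /D; lra.
move/count; rewrite (_ : \sum_(i < n) _ = s n x); last first.
  apply: eq_bigr => i _; rewrite indicE; congr (_ %:R); congr nat_of_bool.
  rewrite ltr_pdivlMr// /h mul1r; apply/idP/idP => [?|/set_mem//].
  exact: mem_set.
rewrite ler_pdivrMr// => /andP[s1]; rewrite -lerBlDr ler_pdivlMr// => s2.
rewrite ler_norml; nra.
Qed.

End test_functions.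

Section pairing.
Context {disp : measure_display} {T : measurableType disp} {R : realType}.
Implicit Types (lam : {charge set T -> \bar R}) (f g : T -> R).

Lemma bmeas_integrable (m : {finite_measure set T -> \bar R}) g :
  bmeas g -> m.-integrable setT (EFin \o g).
Proof.
move=> [mg [C gC]]; apply: measurable_bounded_integrable => //.
  by rewrite ltey_eq fin_num_measure.
exists C; split; first exact: num_real.
by move=> M CM x _; exact: le_trans (gC x) (ltW CM).
Qed.

Definition fmass (m : {measure set T -> \bar R}) : R := fine (m setT).

Lemma Rintegral_bnd (m : {finite_measure set T -> \bar R}) g (C : R) :
  bmeas g -> (forall x, `|g x| <= C) -> `|\int[m]_x g x| <= C * fmass m.
Proof.
move=> bg gC; apply: (le_trans (le_normr_Rintegral _ _)) => //.
  exact: bmeas_integrable.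
rewrite -Rintegral_cst//.
apply: le_Rintegral => //; apply: bmeas_integrable; first exact: bmeas_norm.
exact: bmeas_cst.
Qed.

Lemma cintegral_lin lam f g (k : R) : bmeas f -> bmeas g ->
  cintegral lam (fun x => f x + k * g x) =
  cintegral lam f + k * cintegral lam g.
Proof.
move=> bf bg; rewrite /cintegral !RintegralD//; try exact: bmeas_integrable;
  try (apply: bmeas_integrable; exact: bmeasZ).
by rewrite !RintegralZl//; try exact: bmeas_integrable; ring.
Qed.

Lemma cintegral_cst lam (k : R) :
  cintegral lam (fun=> k) = k * cintegral lam (fun=> 1).
Proof.
by rewrite /cintegral !Rintegral_cst//; ring.
Qed.

Lemma cintegralZ lam g (k : R) : bmeas g ->
  cintegral lam (fun x => k * g x) = k * cintegral lam g.
Proof.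
move=> bg; have := cintegral_lin lam k (bmeas_cst 0) bg.
rewrite cintegral_cst mul0r add0r => <-.
by congr cintegral; apply/funext => x; rewrite add0r.
Qed.

Lemma cintegralB lam f g : bmeas f -> bmeas g ->
  cintegral lam (fun x => f x - g x) = cintegral lam f - cintegral lam g.
Proof.
move=> bf bg; rewrite -mulN1r -cintegral_lin//.
by congr cintegral; apply/funext => x; rewrite mulN1r.
Qed.

Lemma cintegral_sum lam (I : finType) (P : pred I) (k : I -> R)
    (F : I -> T -> R) : (forall i, P i -> bmeas (F i)) ->
  cintegral lam (fun x => \sum_(i | P i) k i * F i x) =
  \sum_(i | P i) k i * cintegral lam (F i).
Proof.
move=> bF; suff H (s : seq I) :
    bmeas (fun x => \sum_(i <- s | P i) k i * F i x) /\
    cintegral lam (fun x => \sum_(i <- s | P i) k i * F i x) =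
    \sum_(i <- s | P i) k i * cintegral lam (F i).
  by have [] := H (index_enum I).
elim: s => [|i s [ihb ih]].
  rewrite big_nil; under eq_fun do rewrite big_nil.
  by rewrite cintegral_cst mul0r; split=> //; exact: bmeas_cst.
rewrite big_cons; case: ifPn => Pi; last first.
  by under eq_fun do rewrite big_cons (negbTE Pi).
under eq_fun do rewrite big_cons Pi addrC.
have bFi := bF i Pi; split; first by apply: bmeasD => //; exact: bmeasZ.
by rewrite cintegral_lin// ih addrC.
Qed.

Lemma tvnormE lam : tvnorm lam =
  fmass (jordan_pos (hahn_posneg lam)) + fmass (jordan_neg (hahn_posneg lam)).
Proof. by rewrite /tvnorm /charge_variation fineD// fin_num_measure. Qed.

Lemma tvnorm_ge0 lam : 0 <= tvnorm lam.
Proof. by rewrite tvnormE addr_ge0// fine_ge0. Qed.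

Lemma cintegral_bnd lam g (C : R) : bmeas g -> (forall x, `|g x| <= C) ->
  `|cintegral lam g| <= tvnorm lam * C.
Proof.
move=> bg gC; apply: (le_trans (ler_normB _ _)).
by rewrite tvnormE mulrC mulrDr lerD// Rintegral_bnd.
Qed.

Lemma Rintegral_indic (m : {finite_measure set T -> \bar R}) A :
  measurable A -> \int[m]_x (\1_A x : R) = fine (m A).
Proof. by move=> mA; rewrite /Rintegral integral_indic// setIT. Qed.

Lemma cintegral_indic lam A : measurable A ->
  cintegral lam \1_A = fine (lam A).
Proof.
move=> mA; rewrite /cintegral !Rintegral_indic//.
rewrite (jordan_decomp (hahn_posneg lam) mA) /cadd/= cscaleN1.
by rewrite fineB// fin_num_measure.
Qed.

(** The Hahn decompositions of the three charges are unrelated, so the equality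
    is checked on sets, where it is clear, and extended to test functions by
    [bmeas_functional_eq0]; so is [cintegral_density]. *)
Lemma cintegral_csub lam lam' g : bmeas g ->
  cintegral (csub lam lam') g = cintegral lam g - cintegral lam' g.
Proof.
move=> bg; apply/eqP; rewrite -subr_eq0; apply/eqP.
pose Phi g := cintegral (csub lam lam') g -
  (cintegral lam g - cintegral lam' g).
apply: (@bmeas_functional_eq0 _ _ _ Phi
  (tvnorm (csub lam lam') + (tvnorm lam + tvnorm lam'))) bg.
- by move=> f h k bf bh; rewrite /Phi !cintegral_lin//; ring.
- move=> f C bf fC; apply: (le_trans (ler_normB _ _)); rewrite !mulrDl.
  rewrite lerD ?cintegral_bnd// (le_trans (ler_normB _ _))//.
  by rewrite lerD ?cintegral_bnd.
- move=> A mA; rewrite /Phi !cintegral_indic// /csub /cadd/= /copp/=.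
  by rewrite fineB ?fin_num_measure// subrr.
Qed.

(** Duality: the total variation norm is attained at the test function
    [1_P - 1_N] of a Hahn decomposition. *)
Lemma tvnorm_le lam (C : R) :
  (forall g, bmeas g -> (forall x, `|g x| <= 1) -> cintegral lam g <= C) ->
  tvnorm lam <= C.
Proof.
move=> H; have [[mP posP] [mN negN] PN PN0] := hahn_posneg lam.
set P := hahn_pos lam in mP posP PN PN0.
set N := hahn_neg lam in mN negN PN PN0.
suff -> : tvnorm lam = cintegral lam (fun x => \1_P x - \1_N x).
  apply: H => [|x]; first by apply: bmeasB; exact: bmeas_indic.
  rewrite !indicE; have := PN0; rewrite -subset0 => /(_ x) PNx.
  case: (boolP (x \in P)) => xP; case: (boolP (x \in N)) => xN;
    rewrite ?subrr ?subr0 ?sub0r ?normrN ?normr0 ?normr1//.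
rewrite cintegralB; [|exact: bmeas_indic|exact: bmeas_indic].
rewrite !cintegral_indic// tvnormE /fmass.
rewrite /= !jordan_posE !jordan_negE !cjordan_posE !cjordan_negE.
rewrite /crestr0 !mem_set//= /crestr !setTI fineN//.
Qed.

Lemma cintegral_ge0_prob lam g :
  (forall B, measurable B -> 0 <= lam B)%E -> bmeas g ->
  (forall x, 0 <= g x) -> 0 <= cintegral lam g.
Proof.
move=> lam0 bg g0; rewrite /cintegral.
have neg0 : fmass (jordan_neg (hahn_posneg lam)) = 0.
  have [_ [mN negN] _ _] := hahn_posneg lam.
  rewrite /fmass /= !jordan_negE !cjordan_negE.
  rewrite /crestr0 !mem_set//= /crestr !setTI.
  suff -> : (lam (hahn_neg lam) = 0)%E by rewrite oppe0.
  by apply/eqP; rewrite eq_le lam0// andbT negN.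
have [_ [C gC]] := bg.
have := Rintegral_bnd (jordan_neg (hahn_posneg lam)) bg gC.
rewrite neg0 mulr0 normr_le0 => /eqP ->.
by rewrite subr0 Rintegral_ge0.
Qed.

Lemma integrable_mul_bmeas (mu : {measure set T -> \bar R}) f g :
  mu.-integrable setT (EFin \o f) -> bmeas g ->
  mu.-integrable setT (EFin \o (fun x => f x * g x)).
Proof.
move=> intf [mg [C gC]].
have := integrableMl measurableT intf mg; apply.
exists C; split; first exact: num_real.
by move=> M CM x _; exact: le_trans (gC x) (ltW CM).
Qed.

Lemma cintegral_density (mu : {measure set T -> \bar R}) f g :
  mu.-integrable setT (EFin \o f) -> bmeas g ->
  cintegral (density_charge mu f) g = \int[mu]_x (f x * g x).
Proof.
move=> intf bg; apply/eqP; rewrite -subr_eq0; apply/eqP.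
have intfg h : bmeas h -> mu.-integrable setT (EFin \o (fun x => f x * h x)).
  exact: integrable_mul_bmeas.
pose Phi g := cintegral (density_charge mu f) g - \int[mu]_x (f x * g x).
apply: (@bmeas_functional_eq0 _ _ _ Phi
  (tvnorm (density_charge mu f) + \int[mu]_x `|f x|)) bg.
- move=> u h k bg bh; rewrite /Phi cintegral_lin//.
  rewrite (_ : \int[mu]_x (f x * (u x + k * h x)) =
    \int[mu]_x (f x * u x) + k * \int[mu]_x (f x * h x)); first ring.
  rewrite -RintegralZl ?intfg// -RintegralD ?intfg//; last first.
    rewrite (_ : _ \o _ = EFin \o (fun x => f x * (k * h x))).
      by apply: intfg; exact: bmeasZ.
    by apply/funext => x /=; rewrite mulrCA.
  by apply: eq_Rintegral => x _; ring.
- move=> u C bg gC; apply: (le_trans (ler_normB _ _)); rewrite mulrDl.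
  rewrite lerD ?cintegral_bnd//.
  apply: (le_trans (le_normr_Rintegral _ (intfg _ bg))) => //.
  rewrite -RintegralZr//; last exact: integrable_norm.
  apply: le_Rintegral => //; first exact/integrable_norm/intfg.
    apply: (@integrable_mul_bmeas _ (fun x => `|f x|)); last exact: bmeas_cst.
    exact: integrable_norm.
  by move=> x _; rewrite normrM ler_wpM2l.
- move=> A mA; rewrite /Phi cintegral_indic// /density_charge.
  case: pselect => [intf'|//]; rewrite -[fine _]/(\int[mu]_(x in A) f x).
  rewrite Rintegral_mkcond; apply/eqP; rewrite subr_eq0; apply/eqP.
  by apply: eq_Rintegral => x _; rewrite patchE indicE; case: ifPn => _;
    rewrite ?mulr1 ?mulr0.
Qed.

End pairing.

(** * Complements on integration *)

Section Rintegral_complements.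
Context {disp : measure_display} {T : measurableType disp} {R : realType}.

Lemma Rintegral_not_integrable (m : {measure set T -> \bar R}) (f : T -> R) :
  measurable_fun setT f -> ~ m.-integrable setT (EFin \o f) ->
  \int[m]_x f x = 0.
Proof.
move=> mf nintf; have mEf : measurable_fun setT (EFin \o f).
  exact/measurable_EFinP.
rewrite /Rintegral integralE.
set P := (\int[m]_x _^\+ x)%E; set N := (\int[m]_x _^\- x)%E.
have P0 : (0 <= P)%E by exact: integral_ge0.
have N0 : (0 <= N)%E by exact: integral_ge0.
have PN : (P + N = +oo)%E.
  rewrite -ge0_integralD//; last 2 first.
  - exact: measurable_funepos.
  - exact: measurable_funeneg.
  apply/eqP; rewrite -leye_eq leNgt; apply/negP => fin; apply: nintf.
  apply/integrableP; split => //.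
  by under eq_integral do rewrite -/((abse \o (EFin \o f)) _) fune_abse.
by case: P P0 PN => [P| |]//; case: N N0 => [N| |].
Qed.

(** If [f] is not integrable then neither is [f * k] for [k != 0], and both
    sides are [0]: a divergent integral has real value [0]. This spares the
    distinction of the points where an inner integral diverges. *)
Lemma Rintegral_mulr_cst (m : {measure set T -> \bar R}) (f : T -> R) (k : R) :
  measurable_fun setT f -> \int[m]_x (f x * k) = \int[m]_x f x * k.
Proof.
move=> mf; have [->|k0] := eqVneq k 0.
  by rewrite mulr0 -[RHS](Rintegral_set0 m (fun=> 0)) /Rintegral
    integral_set0; under eq_integral do rewrite mulr0; rewrite integral0.
have [intf|nintf] := pselect (m.-integrable setT (EFin \o f)).
  by rewrite RintegralZr.
rewrite !Rintegral_not_integrable ?mul0r//; first exact: measurable_funM.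
move=> intfk; apply: nintf.
have := integrableZr measurableT k^-1 intfk; congr (_.-integrable _ _).
by apply/funext => x /=; rewrite -EFinM mulfK.
Qed.

Lemma Rintegral_sum (m : {measure set T -> \bar R}) (I : finType)
    (P : pred I) (w : I -> R) (F : I -> T -> R) :
  (forall i, m.-integrable setT (EFin \o F i)) ->
  m.-integrable setT (EFin \o (fun x => \sum_(i | P i) w i * F i x)) /\
  \int[m]_x (\sum_(i | P i) w i * F i x) =
  \sum_(i | P i) w i * \int[m]_x F i x.
Proof.
move=> iF; elim: (index_enum I) => [|i s [ihi ih]].
  rewrite big_nil; under eq_fun do rewrite big_nil.
  split; first exact: integrable0.
  by rewrite /Rintegral integral0.
rewrite big_cons; case: ifPn => Pi; last first.
  by under eq_fun do rewrite big_cons (negbTE Pi).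
under eq_fun do rewrite big_cons Pi.
have iwF := integrableZl measurableT (w i) (iF i).
split; first exact: (integrableD measurableT iwF ihi).
by rewrite RintegralD// ih RintegralZl.
Qed.

End Rintegral_complements.

Section ae_comparison.
Context {disp : measure_display} {T : measurableType disp} {R : realType}.

Lemma ae_le_of_integral_le (m : {measure set T -> \bar R}) (f g : T -> R) :
  m.-integrable setT (EFin \o f) -> m.-integrable setT (EFin \o g) ->
  (forall A, measurable A ->
     \int[m]_(x in A) (f x)%:E <= \int[m]_(x in A) (g x)%:E)%E ->
  {ae m, forall x, f x <= g x}.
Proof.
move=> intf intg fg.
have mf : measurable_fun setT f.
  by apply/measurable_EFinP; exact: measurable_int intf.
have mg : measurable_fun setT g.
  by apply/measurable_EFinP; exact: measurable_int intg.
pose A := [set x | g x < f x].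
have mA : measurable A.
  rewrite (_ : A = setT `&` (fun x => f x - g x) @^-1` `]0, +oo[%classic).
    exact: (measurable_funB mf mg).
  by rewrite setTI; apply/funext => x; rewrite /A/= in_itv/= andbT subr_gt0.
have intfA := integrableS measurableT mA (@subsetT _ A) intf.
have intgA := integrableS measurableT mA (@subsetT _ A) intg.
have int0 : (\int[m]_(x in A) `|(f x - g x)%:E| = 0)%E.
  apply/eqP; rewrite eq_le integral_ge0// andbT.
  rewrite (_ : integral _ _ _ = \int[m]_(x in A) ((f x)%:E - (g x)%:E))%E.
    rewrite integralB//; rewrite sube_le0; exact: fg.
  apply: eq_integral => x /set_mem Ax.
  by rewrite gee0_abs ?lee_fin ?subr_ge0 ?ltW.
have mfgA : measurable_fun A (fun x => (f x - g x)%:E).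
  by apply/measurable_EFinP; apply: measurable_funTS; exact: measurable_funB.
have /ae_eq_integral_abs := int0 => /(_ mA mfgA).
apply: filterS => x fgA; rewrite leNgt; apply/negP => Ax.
by have := fgA Ax => -[/eqP]; rewrite subr_eq0 gt_eqF.
Qed.

End ae_comparison.

(** * Interchanging the integrals against a possibly non sigma-finite measure *)

Section sigma_finite_restriction.
Context {disp : measure_display} {T : measurableType disp} {R : realType}.
Variable mu : {measure set T -> \bar R}.
Implicit Types (f : T -> \bar R) (D : set T).
Local Open Scope ereal_scope.

Lemma integral_mrestr D (mD : measurable D) f :
  measurable_fun setT f -> {ae mu, forall x, ~ D x -> f x = 0} ->
  \int[mu]_x f x = \int[mrestr mu mD]_x f x.
Proof.
move=> mf f0.
have mfD : measurable_fun setT (f \_ D).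
  by apply/(measurable_restrictT _ _).1 => //; exact: measurable_funTS.
have -> : \int[mu]_x f x = \int[mu]_x (f \_ D) x.
  apply: ae_eq_integral => //; apply: filterS f0 => x f0 _.
  by rewrite patchE; case: ifPn => // /negP xD; apply: f0 => Dx;
    apply: xD; exact: mem_set.
have -> : \int[mrestr mu mD]_x f x = \int[mrestr mu mD]_x (f \_ D) x.
  apply: ae_eq_integral => //; exists (~` D); split.
  - exact: measurableC.
  - by rewrite /= /mrestr setICl measure0.
  - move=> x /= /not_implyP[_]; apply: contra_not => Dx.
    by rewrite patchE mem_set.
rewrite -!integral_mkcond; apply: eq_measure_integral => A mA AD.
by rewrite /= /mrestr setIidl.
Qed.

(** An integrable function lives on a sigma-finite set: the sets where it is
    larger than [1 / n] have finite measure. *)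
Lemma sigma_finite_support f : measurable_fun setT f -> (forall x, 0 <= f x) ->
  \int[mu]_x f x < +oo ->
  forall mD : measurable [set x | 0 < f x], sigma_finite setT (mrestr mu mD).
Proof.
move=> mf f0 foo mD; set D := [set x | 0 < f x] in mD *.
pose e (n : nat) : R := (n.+1%:R^-1)%R.
have e0 n : (0 < e n)%R by rewrite invr_gt0.
pose F n := if n is n'.+1 then [set x | (e n')%:E <= f x] else ~` D.
have mF n : measurable (F n).
  case: n => [|n]; first exact: measurableC.
  by rewrite /F -[X in measurable X]setTI; exact: emeasurable_fun_c_infty.
exists F => [|n].
  apply/esym; rewrite -subTset => x _.
  have [Dx|Dx] := pselect (D x); last by exists 0%N.
  suff [n nx] : exists n, (e n)%:E <= f x by exists n.+1.
  move: Dx; rewrite /D/=; case: (f x) => [r| |//]; last first.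
    by move=> _; exists 0%N; rewrite leey.
  rewrite lte_fin => r0; have /archi_boundP : (0 <= r^-1)%R.
    by rewrite invr_ge0 ltW.
  set n := Num.bound _ => nr; exists n; rewrite lee_fin /e.
  rewrite -[leRHS]invrK lef_pV2 ?posrE ?invr_gt0//.
  by rewrite (le_trans (ltW nr))// ler_nat.
split => //; case: n => [|n].
  by rewrite /F /mrestr setICl measure0.
have mle : mrestr mu mD (F n.+1) <= mu (F n.+1).
  rewrite /= /mrestr; apply: le_measure; rewrite ?inE; last exact: subIsetl.
    exact: measurableI (mF n.+1) mD.
  exact: (mF n.+1).
apply: (le_lt_trans mle).
rewrite -(@lte_pmul2l _ (e n)%:E)// ?lte_fin// -integral_cst//.
rewrite gt0_muley ?lte_fin//.
apply: le_lt_trans foo.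
apply: (@le_trans _ _ (\int[mu]_(x in F n.+1) f x)).
  by apply: ge0_le_integral => //; [move=> x _; rewrite lee_fin ltW
    |exact: measurable_funTS].
by apply: ge0_subset_integral.
Qed.

End sigma_finite_restriction.

Section kernel_fubini.
Context {disp : measure_display} {X : measurableType disp} {R : realType}.
Variable mu : {measure set X -> \bar R}.
Variable r : X -> X -> R.
Variable c : R.
Hypothesis c0 : 0 < c.
Hypothesis mr : measurable_fun setT (fun z : X * X => r z.1 z.2).
Hypothesis r0 : forall x' x, 0 <= r x' x.
Hypothesis r_cmp : forall x x1, {ae mu, forall x', c * r x' x1 <= r x' x}.
Hypothesis r_int : forall x, mu.-integrable setT (EFin \o (r^~ x)).
Hypothesis r_norm : forall lam : probability X R,
  (\int[mu]_x' \int[lam]_x (r x' x)%:E < +oo)%E.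

(** From probabilities to finite measures, by normalisation. *)
Lemma finite_norm (m : {finite_measure set X -> \bar R}) :
  (\int[mu]_x' \int[m]_x (r x' x)%:E < +oo)%E.
Proof.
have mrx x' : measurable_fun setT (fun x => (r x' x)%:E).
  by apply/measurable_EFinP; exact: (measurableT_comp mr (pair1_measurable x')).
have [m0|m0] := eqVneq (m setT) 0%E.
  rewrite integral0_eq ?ltry// => x' _.
  rewrite (eq_measure_integral mzero) ?integral_measure_zero// => A mA _.
  have : (m A <= m setT)%E by apply: le_measure; rewrite ?inE.
  by rewrite m0 => mA0; apply/eqP; rewrite eq_le mA0 measure_ge0.
have mfin : m setT \is a fin_num by rewrite fin_num_measure.
have mpos : 0 < fine (m setT).
  by rewrite fine_gt0// lt0e m0 measure_ge0/= ltey_eq mfin.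
pose P := mnormalize m (\d_(point : X)).
pose k := NngNum (ltW mpos).
have Pk x' : (\int[m]_x (r x' x)%:E = (fine (m setT))%:E *
    \int[P]_x (r x' x)%:E)%E.
  rewrite -[X in (X%:E * _)%E]/(k%:num) -ge0_integral_mscale//; last first.
    by move=> x _; rewrite lee_fin.
  apply: eq_measure_integral => A mA _.
  rewrite [RHS]/= /mscale [X in (_ * X)%E]/= /mnormalize.
  rewrite (negbTE m0)/= (_ : (m setT == +oo)%E = false); last first.
    by apply/negP => /eqP E; move: mfin; rewrite E.
  rewrite muleCA -EFinM divff ?mule1// gt_eqF//.
under eq_integral do rewrite Pk.
rewrite ge0_integralZl//; last 3 first.
- apply: (measurable_fun_fubini_tonelli_F (m2 := P)
    (fun z : X * X => (r z.1 z.2)%:E)) => [|z]; first exact/measurable_EFinP.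
  by rewrite lee_fin.
- by move=> x' _; apply: integral_ge0 => x _; rewrite lee_fin.
- by rewrite lee_fin ltW.
by rewrite lte_mul_pinfty ?lee_fin ?(ltW mpos)// r_norm.
Qed.

Lemma measurable_kernel_l x : measurable_fun setT (r^~ x).
Proof. exact: (measurableT_comp mr (pair2_measurable x)). Qed.

Lemma kernel_int_bound : exists K : R, forall x, \int[mu]_x' r x' x <= K.
Proof.
exists (c^-1 * \int[mu]_x' r x' point) => x.
rewrite ler_pdivlMl// -RintegralZl//.
rewrite /Rintegral fine_le//.
- by apply: integrable_fin_num => //; exact: (integrableZl measurableT c (r_int x)).
- by apply: integrable_fin_num => //; exact: (r_int point).
apply: ae_ge0_le_integral => //.
- by move=> x' _; rewrite lee_fin mulr_ge0// ltW.
- by apply/measurable_EFinP; apply: measurable_funM => //;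
    exact: measurable_kernel_l.
- by move=> x' _; rewrite lee_fin.
- by apply/measurable_EFinP; exact: measurable_kernel_l.
- by apply: filterS (r_cmp point x) => x' H _; rewrite lee_fin.
Qed.

(** The measure [mu] is arbitrary, but both iterated integrals only see its
    restriction to a sigma-finite set [D]. The functions [r (., x)] all
    vanish almost everywhere off [{r (., point) > 0}] since they are
    comparable; this settles the integral that is first in [x']. The
    exceptional null set depends on [x], so the other integral may see more;
    but it only sees the points where [\int r (x', x) m(dx)] is positive, and
    this function of [x'] is integrable by assumption. *)
Lemma kernel_fubini (m : {finite_measure set X -> \bar R}) (phi : X * X -> R)
    (C : R) :
  0 <= C -> measurable_fun setT phi ->
  (forall z, `|phi z| <= C * r z.1 z.2) ->
  [/\ measurable_fun setT (fun x => \int[mu]_x' phi (x', x)),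
      mu.-integrable setT (EFin \o (fun x' => \int[m]_x phi (x', x))) &
      \int[mu]_x' \int[m]_x phi (x', x) = \int[m]_x \int[mu]_x' phi (x', x)].
Proof.
move=> C0 mphi phiC.
pose M x' := (\int[m]_x (r x' x)%:E)%E.
pose G x' := (M x' + (r x' point)%:E)%E.
have M0 x' : (0 <= M x')%E by apply: integral_ge0 => x _; rewrite lee_fin.
have mM : measurable_fun setT M.
  apply: (measurable_fun_fubini_tonelli_F (m2 := m)
    (fun z : X * X => (r z.1 z.2)%:E)) => [|z]; first exact/measurable_EFinP.
  by rewrite lee_fin.
have mrp : measurable_fun setT (fun x' => (r x' point)%:E).
  by apply/measurable_EFinP; exact: measurable_kernel_l.
have mG : measurable_fun setT G by exact: emeasurable_funD.
have G0 x' : (0 <= G x')%E by rewrite adde_ge0 ?lee_fin.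
have Goo : (\int[mu]_x' G x' < +oo)%E.
  rewrite ge0_integralD//; last by move=> x' _; rewrite lee_fin.
  rewrite lte_add_pinfty ?finite_norm//.
  have /integrableP[_] := r_int point.
  by under eq_integral do rewrite /= ger0_norm//.
pose D := [set x' | (0 < G x')%E].
have mD : measurable D.
  by rewrite -[D]setTI; exact: emeasurable_fun_o_infty.
have sig := sigma_finite_support mG G0 Goo mD.
pose nu0 : {measure set X -> \bar R} := mrestr mu mD.
pose sf := @isSFinite.Build _ _ _ nu0 (sfinite_measure_sigma_finite sig).
pose sgf := @isSigmaFinite.Build _ _ _ nu0 sig.
pose nu : sigma_finite_measure X R := HB.pack (Measure.sort nu0) sf sgf.
have offG x' : ~ D x' -> M x' = 0%E /\ r x' point = 0.
  move=> /negP; rewrite -leNgt => G0'; have := M0 x'.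
  rewrite le_eqVlt => /orP[/eqP M0'|Mp].
    by split=> //; apply/eqP; rewrite eq_le r0 andbT -lee_fin; move: G0';
      rewrite /G -M0' add0e.
  by have : (0 < G x')%E by [apply: lte_paddr; rewrite ?lee_fin|];
    rewrite ltNge G0'.
have offr x : {ae mu, forall x', ~ D x' -> r x' x = 0}.
  apply: filterS (r_cmp point x) => x' H /offG[_ rp]; apply/eqP.
  by move: H; rewrite rp pmulr_rle0// eq_le r0 andbT.
have toD x (f : X -> R) : measurable_fun setT f ->
    (forall x', `|f x'| <= C * r x' x) ->
    (\int[mu]_x' (f x')%:E = \int[nu]_x' (f x')%:E)%E.
  move=> mf fr; apply: integral_mrestr; first exact/measurable_EFinP.
  apply: filterS (offr x) => x' H /H rx; have := fr x'.
  by rewrite rx mulr0 normr_le0 => /eqP ->.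
have mphix x : measurable_fun setT (fun x' => phi (x', x)).
  exact: (measurableT_comp mphi (pair2_measurable x)).
have mphix' x' : measurable_fun setT (fun x => phi (x', x)).
  exact: (measurableT_comp mphi (pair1_measurable x')).
have [K rK] := kernel_int_bound.
have Cr_int x : (\int[mu]_x' (C * r x' x)%:E = (C * \int[mu]_x' r x' x)%:E)%E.
  rewrite -RintegralZl ?r_int// fineK//; apply: integrable_fin_num => //.
  exact: (integrableZl measurableT C (r_int x)).
have phir_int x : mu.-integrable setT (EFin \o (fun x' => phi (x', x))).
  apply: (le_integrable measurableT _ _ (integrableZl measurableT C (r_int x))).
    exact/measurable_EFinP.
  by move=> x' _; rewrite lee_fin (le_trans (phiC (x', x)))// ler_norm.
have phi_int : (nu \x m)%E.-integrable setT (EFin \o phi).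
  apply/integrable21ltyP; first exact/measurable_EFinP.
  apply: (@le_lt_trans _ _ (\int[m]_x (cst (C * K)%:E x))%E); last first.
    by rewrite integral_cst//= lte_mul_pinfty ?lee_fin ?mulr_ge0//;
      [rewrite (le_trans _ (rK point))// Rintegral_ge0|
       rewrite ltey_eq fin_num_measure].
  apply: ge0_le_integral => //.
  - by move=> x _; apply: integral_ge0.
  - apply: (measurable_fun_fubini_tonelli_G (m1 := nu)
      (fun z : X * X => `|(phi z)%:E|%E)) => //.
    by apply: measurableT_comp => //; exact/measurable_EFinP.
  - move=> x _; rewrite -(@toD x (fun x' => `|phi (x', x)|)); last 2 first.
    + exact: measurableT_comp.
    + by move=> x'; rewrite normr_id; exact: (phiC (x', x)).
    apply: (@le_trans _ _ (\int[mu]_x' (C * r x' x)%:E)%E).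
      apply: ge0_le_integral => //.
      * by apply/measurable_EFinP; exact: measurableT_comp.
      * by apply/measurable_EFinP; apply: measurable_funM => //;
          exact: measurable_kernel_l.
      * by move=> x' _; rewrite lee_fin (phiC (x', x)).
    by rewrite Cr_int lee_fin ler_wpM2l.
pose F x' := (\int[m]_x (phi (x', x))%:E)%E.
have iF : nu.-integrable setT F by exact: (integrable_fubini_F phi_int).
have mF := measurable_int _ iF.
have mfF : measurable_fun setT (fun x' => fine (F x')).
  by apply: measurableT_comp mF; exact: fine_measurable.
have Foff x' : ~ D x' -> F x' = 0%E.
  move=> /offG[Mx _]; apply/eqP; rewrite -abse_eq0 eq_le abse_ge0 andbT.
  apply: (le_trans (le_abse_integral _ _ _)) => //; first exact/measurable_EFinP.
  apply: (@le_trans _ _ (\int[m]_x (C%:E * (r x' x)%:E))%E).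
    apply: ge0_le_integral => //.
    - by apply: measurableT_comp => //; exact/measurable_EFinP.
    - by apply/measurable_EFinP; apply: measurable_funM => //;
        exact: (measurableT_comp mr (pair1_measurable x')).
    - by move=> x _; rewrite lee_fin (phiC (x', x)).
  rewrite ge0_integralZl//; last 2 first.
  - by apply/measurable_EFinP; exact: (measurableT_comp mr (pair1_measurable x')).
  - by move=> x _; rewrite lee_fin.
  by rewrite -/(M x') Mx mule0.
have muF : (\int[mu]_x' (fine (F x'))%:E = \int[nu]_x' (fine (F x'))%:E)%E.
  apply: integral_mrestr; first exact/measurable_EFinP.
  by apply: aeW => x' /Foff ->.
have nuF : (\int[nu]_x' (fine (F x'))%:E = \int[nu]_x' F x')%E.
  apply: ae_eq_integral => //; first exact/measurable_EFinP.
  by apply: filterS (integrable_ae measurableT iF) => x' H _; rewrite fineK// H.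
have GE x : fubini_G nu (EFin \o phi) x = (\int[mu]_x' phi (x', x))%:E.
  rewrite /fubini_G -(toD x)//.
  by rewrite /Rintegral fineK//; exact: integrable_fin_num (phir_int x).
split.
- rewrite (_ : (fun x => _) = fine \o fubini_G nu (EFin \o phi)).
    apply: measurableT_comp; first exact: fine_measurable.
    exact: measurable_fubini_G phi_int.
  by apply/funext => x /=; rewrite GE.
- apply/integrableP; split; first exact/measurable_EFinP.
  rewrite (@integral_mrestr _ _ _ mu _ mD); last 2 first.
  + by apply: measurableT_comp => //; exact/measurable_EFinP.
  + by apply: aeW => x' /Foff; rewrite /F /= /Rintegral => ->; rewrite normr0.
  have /integrableP[_] := iF; apply: le_lt_trans.
  apply: ae_ge0_le_integral => //.
  + by apply: measurableT_comp => //; exact/measurable_EFinP.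
  + exact: measurableT_comp.
  + apply: filterS (integrable_ae measurableT iF) => x' H _ /=.
    by rewrite -[X in (_ <= `|X|)%E]fineK// H.
- rewrite /Rintegral muF nuF (Fubini phi_int); congr fine.
  by apply: eq_integral => x _; rewrite -GE.
Qed.

End kernel_fubini.

(** * Measurability of the parameter derivatives of a kernel *)

Section measurable_derivatives.
Context {R : realType} {d : nat}.
Implicit Types (D : set 'rV[R]_d) (f g : 'rV[R]_d -> R) (theta : 'rV[R]_d).

Let dir (i : 'I_d) : 'rV[R]_d := delta_mx 0 i.

(** Existence of the iterated directional derivatives. It passes to products
    by induction, the derivative of a product being a sum of products, and it
    makes every derivative a limit of difference quotients of the previous
    one. *)
Fixpoint ntimes_pderivable n D f : Prop :=
  if n is n'.+1 then
    forall i, (forall theta, D theta -> derivable f theta (dir i)) /\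
      ntimes_pderivable n' D (pderiv i f)
  else True.

Lemma ntimes_differentiable_pderivable n D f :
  ntimes_differentiable n D f -> ntimes_pderivable n D f.
Proof.
elim: n f => //= n ih f [df dpf] i; split; last exact: ih.
by move=> theta /df; exact: diff_derivable.
Qed.

Lemma ntimes_pderivableW n D f :
  ntimes_pderivable n.+1 D f -> ntimes_pderivable n D f.
Proof.
elim: n f => // n ih f H i; have [df dpf] := H i; split=> //.
exact: ih.
Qed.

Lemma near_open_eq D f g theta : open D -> D theta ->
  (forall t, D t -> f t = g t) -> {near theta, f =1 g}.
Proof.
move=> oD Dt fg; have : \forall t \near theta, D t by exact: open_nbhs_nbhs.
by apply: filterS => t /fg.
Qed.

Lemma eq_ntimes_pderivable n D f g : open D ->
  (forall t, D t -> f t = g t) ->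
  ntimes_pderivable n D f -> ntimes_pderivable n D g.
Proof.
move=> oD; elim: n f g => // n ih f g fg df i; have [dfi dpf] := df i.
split.
  move=> theta Dt; have := dfi _ Dt; apply: near_eq_derivable.
  exact: near_open_eq fg.
apply: ih dpf => theta Dt; apply: near_eq_derive.
exact: near_open_eq fg.
Qed.

Lemma ntimes_pderivableD n D f g : open D ->
  ntimes_pderivable n D f -> ntimes_pderivable n D g ->
  ntimes_pderivable n D (f + g).
Proof.
move=> oD; elim: n f g => // n ih f g df dg i.
have [dfi dpf] := df i; have [dgi dpg] := dg i; split.
  by move=> theta Dt; apply: derivableD; [exact: dfi|exact: dgi].
apply: eq_ntimes_pderivable (ih _ _ dpf dpg) => // theta Dt.
by rewrite /pderiv deriveD//; [exact: dfi|exact: dgi].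
Qed.

Lemma ntimes_pderivableM n D f g : open D ->
  ntimes_pderivable n D f -> ntimes_pderivable n D g ->
  ntimes_pderivable n D (f * g).
Proof.
move=> oD; elim: n f g => // n ih f g df dg i.
have [dfi dpf] := df i; have [dgi dpg] := dg i; split.
  by move=> theta Dt; apply: derivableM; [exact: dfi|exact: dgi].
apply: (@eq_ntimes_pderivable _ _ (f * pderiv i g + g * pderiv i f)) => //.
  by move=> theta Dt; rewrite /pderiv deriveM//; [exact: dfi|exact: dgi].
by apply: ntimes_pderivableD => //; apply: ih => //; exact: ntimes_pderivableW.
Qed.

Context {disp : measure_display} {Z : measurableType disp}.
Implicit Types F : 'rV[R]_d -> Z -> R.

Lemma measurable_pderiv D F i : open D ->
  (forall theta, D theta -> measurable_fun setT (F theta)) ->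
  (forall z theta, D theta -> derivable (F^~ z) theta (dir i)) ->
  forall theta, D theta -> measurable_fun setT (fun z => pderiv i (F^~ z) theta).
Proof.
move=> oD mF dF theta Dt.
pose h (n : nat) : R := n.+1%:R^-1.
have h0 n : h n != 0 by rewrite invr_eq0.
have hcvg : h n @[n --> \oo] --> 0 by exact: cvg_harmonic.
(* the quotient is replaced by [0] for the finitely many [n] for which the
   shifted parameter may leave [D], where [F] need not be measurable *)
pose Q n z := if `[< D (h n *: dir i + theta) >] then
  (h n)^-1 *: (F (h n *: dir i + theta) z - F theta z) else 0.
apply: (@measurable_fun_cvg _ _ _ _ Q) => [n|z _].
  rewrite /Q; case: asboolP => Dn; last exact: measurable_cst.
  apply: measurable_funM; first exact: measurable_cst.
  by apply: measurable_funB; exact: mF.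
have := dF z _ Dt; rewrite /derivable.
move=> /cvgr_dnbhsP/(_ h (conj h0 hcvg)).
apply: cvg_trans; apply: near_eq_cvg.
have : \forall n \near \oo, D (h n *: dir i + theta).
  have : h n *: dir i + theta @[n --> \oo] --> theta.
    rewrite -[X in _ --> X]add0r -(scale0r (dir i)).
    by apply: cvgD; [exact: cvgZr_tmp|exact: cvg_cst].
  by apply; exact: open_nbhs_nbhs.
by apply: filterS => n Dn; rewrite /Q asboolT.
Qed.

Definition pderivs (s : seq 'I_d) f := foldr pderiv f s.

Lemma measurable_pderivs D F n (s : seq 'I_d) : open D ->
  (forall theta, D theta -> measurable_fun setT (F theta)) ->
  (forall z, ntimes_pderivable n D (F^~ z)) -> (size s <= n)%N ->
  (forall theta, D theta ->
     measurable_fun setT (fun z => pderivs s (F^~ z) theta)) /\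
  (forall z, ntimes_pderivable (n - size s) D (pderivs s (F^~ z))).
Proof.
move=> oD mF dF; elim: s => [|i s ih] sn; first by rewrite subn0.
have [ms ds] := ih (ltnW sn).
have nE : (n - size s = (n - (size s).+1).+1)%N by rewrite subnSK.
split=> [theta Dt|z]; last by have := ds z; rewrite nE => /(_ i)[].
apply: (@measurable_pderiv D (fun t z => pderivs s (F^~ z) t)) => // z t.
by have := ds z; rewrite nE => /(_ i)[+ _]; apply.
Qed.

Lemma mderivE p (a : mindex d p) f :
  mderiv a f = pderivs (flatten [seq nseq (a i) i | i <- enum 'I_d]) f.
Proof.
rewrite /mderiv /pderivs; elim: (enum 'I_d) => //= i s ih.
by rewrite foldr_cat -ih; elim: (a i) => //= n ->.
Qed.

Lemma measurable_mderiv D F p (a : mindex d p) : open D ->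
  (forall theta, D theta -> measurable_fun setT (F theta)) ->
  (forall z, ntimes_pderivable p D (F^~ z)) ->
  forall theta, D theta ->
    measurable_fun setT (fun z => mderiv a (F^~ z) theta).
Proof.
move=> oD mF dF theta Dt.
under eq_fun do rewrite mderivE.
apply: (measurable_pderivs (n := p) oD mF dF _).1 => //.
rewrite size_flatten /shape -map_comp (eq_map (g := fun i => a i)).
  by rewrite sumnE big_map big_enum/=; exact: mabs_le.
by move=> i /=; rewrite size_nseq.
Qed.

Lemma mderiv0 p f : mderiv (mindex0 : mindex d p) f = f.
Proof.
rewrite /mderiv; elim: (enum 'I_d) => //= i s ->.
by rewrite mindex0E.
Qed.


End measurable_derivatives.

(** * Power series of test functions *)

Section test_series.
Context {disp : measure_display} {X : measurableType disp} {R : realType}.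
Context {d p : nat}.
Implicit Types (a b c : mindex d p) (g : X -> R) (u : mindex d p -> X -> R)
  (Lam : vmeas X R d p) (lam : {charge set X -> \bar R}).

Definition vpair Lam (u : mindex d p -> X -> R) a : R :=
  bsum (fun b c => cintegral (Lam b) (u c)) a.

Definition opser (Op : mindex d p -> (X -> R) -> X -> R) u a (x : X) : R :=
  bsum (fun b c => Op b (u c) x) a.

Definition cser g a : X -> R := if a == mindex0 then g else (fun=> 0).

Lemma bsum_cser (T : mindex d p -> (X -> R) -> R) g a :
  (forall b, T b (fun=> 0) = 0) -> bsum (fun b c => T b (cser g c)) a = T a g.
Proof.
move=> T0; rewrite bsumE /cser eqxx /bsum_lt big1 ?add0r// => b /andP[ba nba].
by rewrite msub_eq0// (negbTE nba) T0 mulr0.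
Qed.

Lemma cintegral0 lam : cintegral lam (fun=> 0) = 0.
Proof. by rewrite cintegral_cst mul0r. Qed.

Lemma vpair_cser Lam g a : vpair Lam (cser g) a = cintegral (Lam a) g.
Proof.
rewrite /vpair (bsum_cser (T := fun b => cintegral (Lam b)))// => b.
exact: cintegral0.
Qed.

Lemma bmeas_cser g : bmeas g -> forall a, bmeas (cser g a).
Proof. by move=> bg a; rewrite /cser; case: ifP => // _; exact: bmeas_cst. Qed.

Lemma bmeas_bsum (T : mindex d p -> mindex d p -> X -> R) a :
  (forall b c, bmeas (T b c)) -> bmeas (fun x => bsum (fun b c => T b c x) a).
Proof. by move=> bT; apply: bmeas_sum => b _; exact: bmeasZ. Qed.

Lemma cintegral_bsum lam (T : mindex d p -> mindex d p -> X -> R) a :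
  (forall b c, bmeas (T b c)) ->
  cintegral lam (fun x => bsum (fun b c => T b c x) a) =
  bsum (fun b c => cintegral lam (T b c)) a.
Proof.
move=> bT; rewrite /bsum (cintegral_sum lam (P := mle^~ a)
  (fun b => (mbin a b)%:R) (F := fun b => T b (msub a b)))//.
Qed.

End test_series.

(** * Exponential forgetting of the ratio of backward operators *)

Section backward.
Context {disp : measure_display} {X : measurableType disp} {R : realType}.
Context {d p : nat} {Y : Type}.
Variable Op : Y -> mindex d p -> (X -> R) -> X -> R.
Variable psi : Y -> R.
Variable e : R.
Implicit Types (y : Y) (a b c : mindex d p) (f g : X -> R)
  (u v : mindex d p -> X -> R) (l : seq Y).
Hypothesis e01 : 0 < e < 1.
Hypothesis psi0 : forall y, 0 <= psi y.
Hypothesis Op_bmeas : forall y a g, bmeas g -> bmeas (Op y a g).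
Hypothesis Op_lin : forall y a f g (t : R) x, bmeas f -> bmeas g ->
  Op y a (fun x => f x + t * g x) x = Op y a f x + t * Op y a g x.
Hypothesis Op_mono : forall y f g x, bmeas f -> bmeas g ->
  (forall x, f x <= g x) -> Op y mindex0 f x <= Op y mindex0 g x.
Hypothesis Op_dom : forall y a g x, bmeas g ->
  `|Op y a g x| <= psi y ^+ mabs a * Op y mindex0 (fun x => `|g x|) x.
Hypothesis Op_cmp : forall y g x x1, bmeas g -> (forall x, 0 <= g x) ->
  e * Op y mindex0 g x1 <= Op y mindex0 g x.
Hypothesis Op1_gt0 : forall y x, 0 < Op y mindex0 (fun=> 1) x.

Let e0 : 0 < e. Proof. by have /andP[] := e01. Qed.
Let b0 : bmeas (fun _ : X => 0 : R). Proof. exact: bmeas_cst. Qed.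
Let b1 : bmeas (fun _ : X => 1 : R). Proof. exact: bmeas_cst. Qed.

Definition bmeass u := forall a, bmeas (u a).

Lemma OpB y a f g x : bmeas f -> bmeas g ->
  Op y a (fun x => f x - g x) x = Op y a f x - Op y a g x.
Proof.
move=> bf bg; rewrite -mulN1r -Op_lin//; congr (Op y a _ x).
by apply/funext => z; rewrite mulN1r.
Qed.

Lemma Op0 y a x : Op y a (fun=> 0) x = 0.
Proof.
by have := OpB y a x b0 b0; rewrite !subrr.
Qed.

Lemma OpZ y a g (t : R) x : bmeas g ->
  Op y a (fun x => t * g x) x = t * Op y a g x.
Proof.
move=> bg; have := Op_lin y a t x b0 bg; rewrite Op0 add0r => <-.
by congr (Op y a _ x); apply/funext => z; rewrite add0r.
Qed.

Lemma Op_sum y a (I : finType) (P : pred I) (w : I -> R) (F : I -> X -> R) x :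
  (forall i, bmeas (F i)) ->
  Op y a (fun x => \sum_(i | P i) w i * F i x) x =
  \sum_(i | P i) w i * Op y a (F i) x.
Proof.
move=> bF; suff H (s : seq I) :
    bmeas (fun x => \sum_(i <- s | P i) w i * F i x) /\
    Op y a (fun x => \sum_(i <- s | P i) w i * F i x) x =
    \sum_(i <- s | P i) w i * Op y a (F i) x by have [] := H (index_enum I).
elim: s => [|i s [ihb ih]].
  by rewrite big_nil; under eq_fun do rewrite big_nil; rewrite Op0.
rewrite big_cons; case: ifPn => Pi; last first.
  by under eq_fun do rewrite big_cons (negbTE Pi).
under eq_fun do rewrite big_cons Pi addrC.
split; first by apply: bmeasD => //; exact: bmeasZ.
by rewrite Op_lin// ih addrC.
Qed.

Lemma Op_bsum y a (T : mindex d p -> mindex d p -> X -> R) b x :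
  (forall c c', bmeas (T c c')) ->
  Op y a (fun x => bsum (fun c c' => T c c' x) b) x =
  bsum (fun c c' => Op y a (T c c') x) b.
Proof.
move=> bT; rewrite /bsum (Op_sum y a (mle^~ b)
  (fun c => (mbin b c)%:R) x (F := fun c => T c (msub b c)))//.
Qed.

Lemma Op_ge0 y g x : bmeas g -> (forall x, 0 <= g x) -> 0 <= Op y mindex0 g x.
Proof. by move=> bg g0; rewrite -(Op0 y mindex0 x); exact: Op_mono. Qed.

Lemma Op_gt0 y g (t : R) x : bmeas g -> 0 < t -> (forall x, t <= g x) ->
  0 < Op y mindex0 g x.
Proof.
move=> bg t0 tg; apply: (@lt_le_trans _ _ (t * Op y mindex0 (fun=> 1) x)).
  by rewrite mulr_gt0.
rewrite -OpZ//; apply: Op_mono => // [|z]; first exact: bmeasZ.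
by rewrite mulr1.
Qed.

Lemma opser_bmeass y u : bmeass u -> bmeass (opser (Op y) u).
Proof. by move=> bu a; apply: bmeas_bsum => b c; exact: Op_bmeas. Qed.

Lemma opserB y u v a x : bmeass u -> bmeass v ->
  opser (Op y) (fun b x => u b x - v b x) a x =
  opser (Op y) u a x - opser (Op y) v a x.
Proof.
move=> bu bv; rewrite /opser -bsumB.
by apply: eq_bsum => b c; rewrite OpB.
Qed.

(** The operators act on functions of [x]: they commute with scalar series. *)
Lemma opser_psmul y (w : mindex d p -> R) u a x : bmeass u ->
  opser (Op y) (fun b x => psmul w (u^~ x) b) a x =
  psmul w (opser (Op y) u ^~ x) a.
Proof.
move=> bu; rewrite /opser /psmul.
transitivity (bsum (fun b c => bsum (fun i j => w i * Op y b (u j) x) c) a).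
  apply: eq_bsum => b c; rewrite Op_bsum; last by move=> i j; exact: bmeasZ.
  by apply: eq_bsum => i j; rewrite OpZ.
rewrite -(bsumA (fun b i j => w i * Op y b (u j) x)).
under eq_bsum do rewrite bsumC.
rewrite (bsumA (fun i b j => w i * Op y b (u j) x)).
by apply: eq_bsum => b c; rewrite bsumZ.
Qed.

Lemma opser_bound y u h (t M : R) : bmeass u -> bmeas h -> 0 <= t -> 0 <= M ->
  (forall a x, `|u a x| <= t * M ^+ mabs a * h x) ->
  forall a x, `|opser (Op y) u a x| <=
    t * (psi y + M) ^+ mabs a * Op y mindex0 h x.
Proof.
move=> bu bh t0 M0 uh a x; rewrite -bsum_pow mulrAC -bsumZ.
apply: bsum_le_norm => b c; apply: (le_trans (Op_dom _ _ _ (bu c))).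
rewrite [leRHS](_ : _ = psi y ^+ mabs b *
  (t * M ^+ mabs c * Op y mindex0 h x)); last by ring.
rewrite ler_wpM2l ?exprn_ge0// -OpZ//.
apply: Op_mono => //; first exact: bmeas_norm.
exact: bmeasZ.
Qed.

Fixpoint bwd l u := if l is y :: l' then opser (Op y) (bwd l' u) else u.

Definition bwd1 l := bwd l (cser (fun=> 1)).

Definition psis l : R := \sum_(y <- l) psi y.

Lemma psis_ge0 l : 0 <= psis l.
Proof. by apply: sumr_ge0 => y _. Qed.

Lemma psis_cons y l : psis (y :: l) = psi y + psis l.
Proof. by rewrite /psis big_cons. Qed.

Lemma bwd_bmeass l u : bmeass u -> bmeass (bwd l u).
Proof. by move=> bu; elim: l => //= y l ih; exact: opser_bmeass. Qed.

Lemma bwd1_bmeass l : bmeass (bwd1 l).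
Proof. by apply: bwd_bmeass; exact: bmeas_cser. Qed.

Lemma bwd1_cons0 y l x :
  bwd1 (y :: l) mindex0 x = Op y mindex0 (bwd1 l mindex0) x.
Proof. by rewrite /bwd1 /= /opser bsum0. Qed.

(** The uniform lower bound keeps the quotients by [bwd1 l] bounded. *)
Lemma bwd1_cmp_gt0 l :
  (forall x x1, e * bwd1 l mindex0 x1 <= bwd1 l mindex0 x) /\
  exists2 t : R, 0 < t & forall x, t <= bwd1 l mindex0 x.
Proof.
elim: l => [|y l [ihc [t t0 th]]].
  rewrite /bwd1 /= /cser eqxx; split; last by exists 1.
  by move=> _ _; rewrite mulr1; have /andP[_ /ltW] := e01.
have h0 x : 0 <= bwd1 l mindex0 x by rewrite (le_trans (ltW t0)).
have C x x1 : e * bwd1 (y :: l) mindex0 x1 <= bwd1 (y :: l) mindex0 x.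
  by rewrite !bwd1_cons0; apply: Op_cmp => //; exact: bwd1_bmeass.
split=> //; exists (e * bwd1 (y :: l) mindex0 point) => //.
rewrite mulr_gt0// bwd1_cons0; apply: Op_gt0 t0 th.
exact: bwd1_bmeass.
Qed.

Lemma bwd1_gt0 l x : 0 < bwd1 l mindex0 x.
Proof. by have [_ [t t0 th]] := bwd1_cmp_gt0 l; exact: lt_le_trans (th x). Qed.

(** Each operator series is dominated, coefficient by coefficient, by its
    term of order [0] times [exp (psi y (t_1 + ... + t_d))]. The exponentials
    multiply, hence the sum of the [psi y] in the bound for the product. *)
Lemma bwd_bound l g : bmeas g -> (forall x, `|g x| <= 1) -> forall a x,
  `|bwd l (cser g) a x| <= psis l ^+ mabs a * bwd1 l mindex0 x.
Proof.
move=> bg g1; elim: l => [|y l ih] a x.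
  rewrite /bwd1/= /cser eqxx mulr1; case: ifPn => [/eqP ->|a0].
    by rewrite mabs0 expr0.
  by rewrite normr0 exprn_ge0// psis_ge0.
rewrite psis_cons bwd1_cons0 /=.
have := opser_bound y (bwd_bmeass l (bmeas_cser bg)) (bwd1_bmeass l mindex0)
  ler01 (psis_ge0 l) (h := bwd1 l mindex0).
move=> /(_ _ a x); rewrite mul1r; apply=> b z.
by rewrite mul1r.
Qed.

(** One order at a time, by division by [v mindex0], which keeps the functions
    bounded since [v mindex0] is bounded below by [t > 0]. *)
Lemma quotient_exists u v (t : R) : bmeass u -> bmeass v -> 0 < t ->
  (forall x, t <= v mindex0 x) ->
  exists2 w, bmeass w & forall x, psmul (w^~ x) (v^~ x) =1 u^~ x.
Proof.
move=> bu bv t0 tv.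
suff [w bw wE] : exists2 w, bmeass w &
    forall x a, (mabs a < p.+1)%N -> psmul (w^~ x) (v^~ x) a = u a x.
  by exists w => // x a; rewrite wE// ltnS mabs_le.
elim: p.+1 => [|n [w bw wE]]; first by exists (fun _ _ => 0).
pose w' a := if (mabs a < n)%N then w a else
  fun x => (u a x - bsum_lt (fun b c => w b x * v c x) a) / v mindex0 x.
exists w' => [a|x a an].
  rewrite /w'; case: ifP => // _; apply: bmeas_divr t0 tv => //.
  apply: bmeasB => //; apply: bmeas_sum => b _.
  by apply: bmeasZ; exact: bmeasM.
rewrite psmulE (_ : bsum_lt _ a = bsum_lt (fun b c => w b x * v c x) a).
  rewrite /w'; case: ifPn => an'; first by rewrite -psmulE wE.
  by rewrite divfK ?gt_eqF// ?(lt_le_trans t0)// addrC subrK.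
apply: eq_bigr => b /andP[ba nba].
by rewrite /w' (leq_trans (mle_abs_lt ba nba)).
Qed.

(** The operator [g |-> Op y (h g) / Op y h] is Markov, and it is minorised
    since both the numerator and the denominator vary with the starting point
    by a factor [e] at most; hence it contracts oscillations. *)
Lemma doeblin y h f (o : R) : bmeas h -> (forall x, 0 <= h x) ->
  (forall x, 0 < Op y mindex0 h x) -> bmeas f ->
  (forall x x1, f x - f x1 <= o) -> forall x x1,
  Op y mindex0 (fun x => f x * h x) x / Op y mindex0 h x -
  Op y mindex0 (fun x => f x * h x) x1 / Op y mindex0 h x1 <=
  (1 - e ^+ 2) * o.
Proof.
move=> bh h0 H0 bf fo x x1.
have o0 : 0 <= o by have := fo x x; rewrite subrr.
pose s := inf (range f).
have hinf : has_inf (range f).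
  split; first by exists (f x), x.
  by exists (f x - o) => _ [z _ <-]; have := fo x z; lra.
have fs z : 0 <= f z - s <= o.
  apply/andP; split.
    by rewrite subr_ge0; apply: ge_inf; [exact: hinf.2|exists z].
  rewrite lerBlDr -lerBlDl; apply: lb_le_inf; first exact: hinf.1.
  by move=> _ [z1 _ <-]; have := fo z z1; lra.
pose g z := (f z - s) * h z.
have bg : bmeas g by apply: bmeasM => //; apply: bmeasB => //; exact: bmeas_cst.
have g0 z : 0 <= g z by rewrite mulr_ge0//; have /andP[] := fs z.
have PE z : Op y mindex0 (fun x => f x * h x) z / Op y mindex0 h z =
    s + Op y mindex0 g z / Op y mindex0 h z.
  rewrite (_ : Op y mindex0 (fun x => f x * h x) z =
    Op y mindex0 g z + s * Op y mindex0 h z).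
    by rewrite mulrDl mulfK ?gt_eqF// addrC.
  rewrite -Op_lin//; congr (Op y mindex0 _ z).
  by apply/funext => z1; rewrite /g; ring.
rewrite !PE opprD addrACA subrr add0r.
set A := Op y _ g x; set A1 := Op y _ g x1.
set H := Op y _ h x; set H1 := Op y _ h x1.
have H_gt0 : 0 < H by exact: H0.
have H1_gt0 : 0 < H1 by exact: H0.
have AoH : A <= o * H.
  rewrite -OpZ//; apply: Op_mono => //; first exact: bmeasZ.
  by move=> z; rewrite /g ler_wpM2r//; have /andP[] := fs z.
have A0 : 0 <= A by exact: Op_ge0.
have eA : e * A <= A1 by exact: Op_cmp.
have eH : e * H1 <= H by exact: Op_cmp.
have A1H1 : e ^+ 2 * (A / H) <= A1 / H1.
  rewrite ler_pdivlMr// mulrA mulrAC ler_pdivrMr//.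
  rewrite (_ : _ * A * H1 = (e * A) * (e * H1)); last by ring.
  by rewrite ler_pM// ?mulr_ge0// ltW.
have Ao : A / H <= o by rewrite ler_pdivrMr.
have e21 : e ^+ 2 <= 1 by rewrite exprn_ile1 ?ltW//; have /andP[] := e01.
apply: (@le_trans _ _ ((1 - e ^+ 2) * (A / H))).
  by rewrite mulrBl mul1r lerD2l lerN2.
by rewrite ler_wpM2l// subr_ge0.
Qed.

(** The terms of lower order in a product of geometric bounds: compared to
    [(B Psi) ^ j] they are smaller by a factor [B]. *)
Lemma pow_gap (x z Psi B : R) j : (j <= p)%N -> 1 <= B -> 0 <= z <= Psi ->
  Psi <= x <= 4 * B * Psi ->
  (x + z) ^+ j - x ^+ j <= 8 ^+ p / B * (B * Psi) ^+ j.
Proof.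
move=> jp B1 /andP[z0 zP] /andP[Px xP].
have B0 : 0 < B by exact: lt_le_trans B1.
have P0 : 0 <= Psi by exact: le_trans zP.
have x0 : 0 <= x by exact: le_trans Px.
case: j jp => [|j] jp.
  by rewrite !expr0 subrr mulr1 divr_ge0 ?exprn_ge0// ltW.
have := @expr_add_le _ x z j; rewrite z0 (le_trans zP Px) addrC => /(_ isT) H.
rewrite lerBlDl (le_trans H)// lerD2l.
have BP0 : 0 <= B * Psi by rewrite mulr_ge0// ltW.
apply: (@le_trans _ _ (2 ^+ j.+1 * Psi * (4 ^+ j * (B * Psi) ^+ j))).
  rewrite ler_pM ?mulr_ge0 ?exprn_ge0//; first by rewrite ler_wpM2l ?exprn_ge0.
  by rewrite -exprMn lerXn2r ?nnegrE ?mulr_ge0//; lra.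
rewrite (_ : 8 ^+ p / B * _ = 8 ^+ p * Psi * (B * Psi) ^+ j); last first.
  by rewrite exprS; field; rewrite gt_eqF.
rewrite mulrA ler_wpM2r ?exprn_ge0// mulrAC ler_wpM2r//.
apply: (@le_trans _ _ (2 ^+ j.+1 * 4 ^+ j.+1)).
  by rewrite ler_wpM2l ?exprn_ge0// ler_weXn2l// ler1n.
rewrite -exprMn (_ : 2 * 4 = 8 :> R); last by ring.
by rewrite ler_weXn2l// ler1n.
Qed.

(** The ratio [w] of the backward images of [g] and of [1] forgets its starting
    point exponentially fast, at every order of differentiation. With
    [z = w - c] for a scalar series [c], one more step of the recursion turns
    [z] into [Z = w' - c] with [Z * h' = Op (h * z)]. At order [a], the term
    that involves [z a] is contracted by [doeblin]; the others involve lower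
    orders only, hence lose a factor [B], and [B] is chosen to make them small
    compared to what the contraction gains. *)
Lemma ratio_osc (B : R) l (Psi : R) g :
  1 <= B -> 2 ^+ p <= B + 1 -> 12 * 8 ^+ p <= e ^+ 2 * B ->
  psis l <= Psi -> bmeas g -> (forall x, `|g x| <= 1) ->
  exists w, [/\ bmeass w,
    forall x, psmul (w^~ x) (bwd1 l ^~ x) =1 (bwd l (cser g))^~ x &
    forall a x x1, w a x - w a x1 <=
      2 * (1 - e ^+ 2 / 2) ^+ size l * (B * Psi) ^+ mabs a].
Proof.
move=> B1 pB eB + bg g1.
have B0 : 0 < B by exact: lt_le_trans B1.
set tau := 1 - e ^+ 2 / 2.
have e21 : e ^+ 2 <= 1 by rewrite exprn_ile1 ?ltW//; have /andP[] := e01.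
have tau0 : 0 <= tau by rewrite /tau; lra.
elim: l => [|y l ih] lPsi.
  have P0 : 0 <= Psi by apply: le_trans lPsi; exact: psis_ge0.
  exists (cser g); split => [|x a|a x x1]; first exact: bmeas_cser.
    rewrite /bwd1 /= /psmul.
    rewrite (@bsum_cser _ X R d p (fun b h => cser g b x * h x))//.
      by rewrite mulr1.
    by move=> b; rewrite mulr0.
  rewrite expr0 mulr1 /cser; case: ifPn => [/eqP ->|_].
    rewrite mabs0 expr0 mulr1.
    have := g1 x; have := g1 x1; rewrite !ler_norml.
    by move=> /andP[? ?] /andP[? ?]; lra.
  by rewrite subrr !mulr_ge0// exprn_ge0// mulr_ge0// ltW.
have psiy := psi0 y; have psil := psis_ge0 l.
move: lPsi; rewrite psis_cons => lPsi.
have P0 : 0 <= Psi by lra.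
have [|w [bw wE wosc]] := ih; first by lra.
set t := 2 * tau ^+ size l in wosc.
have t0 : 0 <= t by rewrite mulr_ge0// exprn_ge0.
have BP0 : 0 <= B * Psi by rewrite mulr_ge0// ltW.
have PBP : Psi <= B * Psi by rewrite ler_peMl.
set h := bwd1 l; set h' := bwd1 (y :: l).
have bh : bmeass h by exact: bwd1_bmeass.
have bh' : bmeass h' by exact: bwd1_bmeass.
have h0 x : 0 < h mindex0 x by exact: bwd1_gt0.
have h'0 x : 0 < h' mindex0 x by exact: bwd1_gt0.
have bG : bmeass (bwd l (cser g)) by apply: bwd_bmeass; exact: bmeas_cser.
have [W bW WE] : exists2 W, bmeass W &
    forall x, psmul (W^~ x) (h'^~ x) =1 (bwd (y :: l) (cser g))^~ x.
  have [_ [s s0 sh]] := bwd1_cmp_gt0 (y :: l).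
  by apply: quotient_exists s0 sh => //; exact: opser_bmeass.
exists W; split => //.
(* any series of values of [w] serves as a centre, since only oscillations
   matter *)
pose c b := w b point.
pose z b x := w b x - c b.
pose Z b x := W b x - c b.
pose hz b x := psmul (z^~ x) (h^~ x) b.
have bz b : bmeas (z b) by apply: bmeasB => //; exact: bmeas_cst.
have bhz : bmeass hz by move=> b; apply: bmeas_bsum => i j; exact: bmeasM.
have bch : bmeass (fun b x => psmul c (h^~ x) b).
  by move=> b; apply: bmeas_bsum => i j; exact: bmeasZ.
have psmulBl (u1 u2 v : mindex d p -> R) b :
    psmul (fun b => u1 b - u2 b) v b = psmul u1 v b - psmul u2 v b.
  by rewrite /psmul -bsumB; apply: eq_bsum => i j; rewrite mulrBl.
have ZE x : psmul (Z^~ x) (h'^~ x) =1 (opser (Op y) hz)^~ x.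
  move=> b; rewrite /Z (psmulBl _ c) WE /= -opser_psmul// -opserB//.
  congr (opser (Op y) _ b x); apply/funext => i; apply/funext => x1.
  by rewrite /hz /z (psmulBl _ c) wE.
have zB b x : `|z b x| <= t * (B * Psi) ^+ mabs b.
  by rewrite /z ler_norml lerNl opprB !wosc.
have hB b x : `|h b x| <= psis l ^+ mabs b * h mindex0 x.
  by apply: bwd_bound => // x1; rewrite normr1.
have h'B b x : `|h' b x| <= (psi y + psis l) ^+ mabs b * h' mindex0 x.
  by rewrite -psis_cons; apply: bwd_bound => // x1; rewrite normr1.
have hzB b x : `|hz b x| <= t * (B * Psi + psis l) ^+ mabs b * h mindex0 x.
  rewrite -bsum_pow mulrAC -bsumZ; apply: bsum_le_norm => i j.
  rewrite normrM (le_trans (ler_pM _ _ (zB i x) (hB j x)))//.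
  by rewrite le_eqVlt; apply/orP; left; apply/eqP; ring.
have OpzB b x : `|opser (Op y) hz b x| <=
    t * (psi y + (B * Psi + psis l)) ^+ mabs b * h' mindex0 x.
  by rewrite /h' bwd1_cons0; apply: opser_bound => //; rewrite addr_ge0.
have ZB b x : `|Z b x| <= t * (2 * ((B + 1) * Psi)) ^+ mabs b.
  apply: (quotient_bound (ZE x) (h'0 x) t0 ler01 P0).
  - by rewrite ler_peMl//; lra.
  - by rewrite mul1r ler_wpM2r.
  - move=> i; apply: (le_trans (OpzB i x)).
    rewrite ler_wpM2r ?(ltW (h'0 x))// ler_wpM2l// lerXn2r ?nnegrE; lra.
  - move=> i _; apply: (le_trans (h'B i x)); rewrite mul1r.
    by rewrite ler_wpM2r ?(ltW (h'0 x))// lerXn2r ?nnegrE; lra.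
move=> a.
set k := 8 ^+ p / B.
set o := t * (B * Psi) ^+ mabs a in wosc *.
have ajp := mabs_le a.
have o0 : 0 <= o by rewrite mulr_ge0// exprn_ge0.
pose P x := Op y mindex0 (fun x => z a x * h mindex0 x) x /
  Op y mindex0 (h mindex0) x.
(* [P x] is the contracted part of [Z a x]; the three remainders come from the
   derivatives of the operator, of [h] and of [h'] *)
have key x : `|Z a x - P x| <= 3 * k * o.
  rewrite -(ler_pM2r (h'0 x)) -{1}(gtr0_norm (h'0 x)) -normrM mulrBl.
  rewrite /P -bwd1_cons0 -/h' divfK ?gt_eqF//.
  have E1 : Z a x * h' mindex0 x = opser (Op y) hz a x -
      bsum_lt (fun b c => Z b x * h' c x) a.
    by rewrite -ZE psmulE addrC addKr.
  have E2 : opser (Op y) hz a x =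
      bsum_lt (fun c b => Op y b (hz c) x) a + Op y mindex0 (hz a) x.
    by rewrite /opser bsumC bsumE.
  pose lz x := bsum_lt (fun b c => z b x * h c x) a.
  have blz : bmeas lz.
    by apply: bmeas_sum => b _; apply: bmeasZ; exact: bmeasM.
  have E3 : Op y mindex0 (hz a) x =
      Op y mindex0 (fun x => z a x * h mindex0 x) x + Op y mindex0 lz x.
    rewrite -[X in _ + X]mul1r -Op_lin//; last exact: bmeasM.
    congr (Op y mindex0 _ x); apply/funext => x1.
    by rewrite /hz psmulE addrC mul1r.
  have gap (T : mindex d p -> mindex d p -> R) (s q q' : R) : 0 <= s ->
      0 <= q' <= Psi -> Psi <= q <= 4 * B * Psi ->
      (forall b c, `|T b c| <= t * s * (q ^+ mabs b * q' ^+ mabs c)) ->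
      `|bsum_lt T a| <= k * o * s.
    move=> s0 q'P qP TB.
    apply: (@le_trans _ _ (t * s * ((q + q') ^+ mabs a - q ^+ mabs a))).
      rewrite -bsum_lt_pow {2}/bsum_lt mulr_sumr.
      apply: (@le_trans _ _ (bsum_lt (fun b c =>
          t * s * (q ^+ mabs b * q' ^+ mabs c)) a)).
        by apply: bsum_lt_le_norm => b c' _ _.
      by apply: ler_sum => b _; rewrite mulrCA.
    rewrite (_ : k * o * s = t * s * (k * (B * Psi) ^+ mabs a)); last first.
      by rewrite /o; ring.
    by apply: ler_wpM2l; [exact: mulr_ge0|exact: pow_gap].
  have R1 : `|bsum_lt (fun c b => Op y b (hz c) x) a| <= k * o * h' mindex0 x.
    apply: (gap _ _ (B * Psi + psis l) (psi y)) => [|||b c'].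
    - exact: ltW.
    - by rewrite psiy; lra.
    - by apply/andP; split; lra.
    - apply: (le_trans (Op_dom _ _ _ (bhz b))).
      rewrite [leRHS](_ : _ = psi y ^+ mabs c' *
        (t * (B * Psi + psis l) ^+ mabs b * h' mindex0 x)); last by ring.
      rewrite ler_wpM2l ?exprn_ge0// /h' bwd1_cons0 -OpZ//.
      by apply: Op_mono => //; [exact: bmeas_norm|exact: bmeasZ].
  have R2 : `|Op y mindex0 lz x| <= k * o * h' mindex0 x.
    apply: (le_trans (Op_dom _ _ _ blz)); rewrite mabs0 expr0 mul1r.
    rewrite /h' bwd1_cons0 -OpZ//; apply: Op_mono => // [||x1].
    - exact: bmeas_norm.
    - exact: bmeasZ.
    - apply: (gap _ _ (B * Psi) (psis l)) => [|||b c'].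
      + exact: ltW.
      + by rewrite psil; lra.
      + by rewrite PBP; lra.
      + rewrite -/h normrM (le_trans (ler_pM _ _ (zB b x1) (hB c' x1)))//.
        by rewrite le_eqVlt; apply/orP; left; apply/eqP; ring.
  have R3 : `|bsum_lt (fun b c => Z b x * h' c x) a| <= k * o * h' mindex0 x.
    apply: (gap _ _ (2 * ((B + 1) * Psi)) (psi y + psis l)) => [|||b c'].
    - exact: ltW.
    - by apply/andP; split; lra.
    - by apply/andP; split; nra.
    - rewrite normrM (le_trans (ler_pM _ _ (ZB b x) (h'B c' x)))//.
      by rewrite le_eqVlt; apply/orP; left; apply/eqP; ring.
  rewrite E1 E2 E3.
  move: R1 R2 R3; rewrite !ler_norml => /andP[? ?] /andP[? ?] /andP[? ?].
  by apply/andP; split; lra.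
move=> x x1.
have PP : P x - P x1 <= (1 - e ^+ 2) * o.
  apply: doeblin => // [x2|x2|x2 x3].
  - exact: ltW.
  - by rewrite -bwd1_cons0; exact: h'0.
  - by rewrite /z opprB addrA subrK; exact: wosc.
have k6 : 6 * k <= e ^+ 2 / 2.
  rewrite /k mulrA ler_pdivrMr//; lra.
have := ler_wpM2r o0 k6 => ko.
rewrite [leRHS](_ : _ = tau * o); last by rewrite exprS /o /t; ring.
have -> : W a x - W a x1 = Z a x - Z a x1 by rewrite /Z; ring.
move: (key x) (key x1); rewrite !ler_norml => /andP[? ?] /andP[? ?].
rewrite /tau; lra.
Qed.

End backward.

(** * Growth and stability of the iterated updates *)

Section stability.
Context {disp : measure_display} {X : measurableType disp} {R : realType}.
Context {d p : nat} {Y : Type}.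
Variable Op : Y -> mindex d p -> (X -> R) -> X -> R.
Variable step : Y -> vmeas X R d p -> vmeas X R d p.
Variable psi : Y -> R.
Variable e : R.
Implicit Types (y : Y) (a b c : mindex d p) (g : X -> R)
  (u v : mindex d p -> X -> R) (l : seq Y) (Lam : vmeas X R d p).
Hypothesis e01 : 0 < e < 1.
Hypothesis psi1 : forall y, 1 <= psi y.
Hypothesis Op_bmeas : forall y a g, bmeas g -> bmeas (Op y a g).
Hypothesis Op_lin : forall y a (f g : X -> R) (t : R) x, bmeas f -> bmeas g ->
  Op y a (fun x => f x + t * g x) x = Op y a f x + t * Op y a g x.
Hypothesis Op_mono : forall y (f g : X -> R) x, bmeas f -> bmeas g ->
  (forall x, f x <= g x) -> Op y mindex0 f x <= Op y mindex0 g x.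
Hypothesis Op_dom : forall y a g x, bmeas g ->
  `|Op y a g x| <= psi y ^+ mabs a * Op y mindex0 (fun x => `|g x|) x.
Hypothesis Op_cmp : forall y g x x1, bmeas g -> (forall x, 0 <= g x) ->
  e * Op y mindex0 g x1 <= Op y mindex0 g x.
Hypothesis Op1_gt0 : forall y x, 0 < Op y mindex0 (fun=> 1) x.
Hypothesis step_quotient : forall y Lam g a, bmeas g ->
  0 < cintegral (Lam mindex0) (Op y mindex0 (fun=> 1)) ->
  psmul (fun b => cintegral (step y Lam b) g)
    (vpair Lam (fun b => Op y b (fun=> 1))) a =
  vpair Lam (fun b => Op y b g) a.

Let e0 : 0 < e. Proof. by have /andP[] := e01. Qed.
Let psi0 y : 0 <= psi y. Proof. exact: le_trans (psi1 y). Qed.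
Let b1 : bmeas (fun _ : X => 1 : R). Proof. exact: bmeas_cst. Qed.

(** What is used of a probability measure once measures are functionals. *)
Definition normalised Lam :=
  (forall g, bmeas g -> (forall x, 0 <= g x) ->
     0 <= cintegral (Lam mindex0) g) /\
  cintegral (Lam mindex0) (fun=> 1) = 1.

Lemma normalised_le Lam f g : normalised Lam -> bmeas f -> bmeas g ->
  (forall x, f x <= g x) ->
  cintegral (Lam mindex0) f <= cintegral (Lam mindex0) g.
Proof.
move=> [pos _] bf bg fg; rewrite -subr_ge0 -cintegralB//.
by apply: pos => [|x]; [exact: bmeasB|rewrite subr_ge0].
Qed.

Lemma normalised_cst Lam (t : R) : normalised Lam ->
  cintegral (Lam mindex0) (fun=> t) = t.
Proof. by move=> [_ Lam1]; rewrite cintegral_cst Lam1 mulr1. Qed.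

Lemma normalised_gt0 Lam g (t : R) : normalised Lam -> bmeas g -> 0 < t ->
  (forall x, t <= g x) -> 0 < cintegral (Lam mindex0) g.
Proof.
move=> nL bg t0 tg; apply: (lt_le_trans t0).
by rewrite -(normalised_cst t nL); apply: normalised_le => //; exact: bmeas_cst.
Qed.

Lemma step_denom_gt0 y Lam : normalised Lam ->
  0 < cintegral (Lam mindex0) (Op y mindex0 (fun=> 1)).
Proof.
move=> nL; apply: (@normalised_gt0 _ _ (e * Op y mindex0 (fun=> 1) point)) => //.
- exact: Op_bmeas.
- by rewrite mulr_gt0.
- by move=> x; apply: Op_cmp.
Qed.

Lemma normalised_step y Lam : normalised Lam -> normalised (step y Lam).
Proof.
move=> nL; have Z0 := step_denom_gt0 y nL.
have E g : bmeas g -> cintegral (step y Lam mindex0) g =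
    cintegral (Lam mindex0) (Op y mindex0 g) /
    cintegral (Lam mindex0) (Op y mindex0 (fun=> 1)).
  move=> bg; have := step_quotient mindex0 bg Z0.
  by rewrite /psmul /vpair !bsum0 => <-; rewrite mulfK// gt_eqF.
split=> [g bg g0|]; last by rewrite E// divff// gt_eqF.
rewrite E// divr_ge0 ?(ltW Z0)//; apply: nL.1; first exact: Op_bmeas.
by move=> x; exact: (Op_ge0 Op_lin Op_mono).
Qed.

Lemma eq_vpair Lam u v a :
  (forall b, u b = v b) -> vpair Lam u a = vpair Lam v a.
Proof. by move=> uv; apply: eq_bsum => b c; rewrite uv. Qed.

Lemma vpairB Lam u v a : bmeass u -> bmeass v ->
  vpair Lam (fun b x => u b x - v b x) a = vpair Lam u a - vpair Lam v a.
Proof.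
move=> bu bv; rewrite /vpair -bsumB.
by apply: eq_bsum => b c; rewrite cintegralB.
Qed.

Lemma vpair_psmul Lam (w : mindex d p -> R) u a : bmeass u ->
  vpair Lam (fun b x => psmul w (u^~ x) b) a = psmul w (vpair Lam u) a.
Proof.
move=> bu; rewrite /vpair /psmul.
transitivity (bsum (fun b c =>
    bsum (fun i j => w i * cintegral (Lam b) (u j)) c) a).
  apply: eq_bsum => b c.
  rewrite cintegral_bsum; last by move=> i j; exact: bmeasZ.
  by apply: eq_bsum => i j; rewrite cintegralZ.
rewrite -(bsumA (fun b i j => w i * cintegral (Lam b) (u j))).
under eq_bsum do rewrite bsumC.
rewrite (bsumA (fun i b j => w i * cintegral (Lam b) (u j))).
by apply: eq_bsum => b c; rewrite bsumZ.
Qed.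

Lemma vpair_vsub Lam Lam' u a : bmeass u ->
  vpair (vsub Lam Lam') u a = vpair Lam u a - vpair Lam' u a.
Proof.
move=> bu; rewrite /vpair -bsumB; apply: eq_bsum => b c.
by rewrite cintegral_csub.
Qed.

Lemma vpair_opser y Lam u a : bmeass u ->
  vpair Lam (opser (Op y) u) a =
  bsum (fun b c => vpair Lam (fun i => Op y i (u c)) b) a.
Proof.
move=> bu; rewrite /vpair /opser (bsumA (fun i j c =>
  cintegral (Lam i) (Op y j (u c)))).
apply: eq_bsum => b c; rewrite cintegral_bsum// => i j.
exact: Op_bmeas.
Qed.

Lemma step_series y Lam u : normalised Lam -> bmeass u ->
  psmul (vpair (step y Lam) u) (vpair Lam (bwd1 Op [:: y])) =1
  vpair Lam (opser (Op y) u).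
Proof.
move=> nL bu a; have Z0 := step_denom_gt0 y nL.
rewrite vpair_opser//.
have D1 b : vpair Lam (bwd1 Op [:: y]) b =
    vpair Lam (fun i => Op y i (fun=> 1)) b.
  apply: eq_vpair => i; apply/funext => x; rewrite /bwd1 /= /opser.
  rewrite (bsum_cser (T := fun b h => Op y b h x))// => b'.
  exact: (Op0 Op_lin).
under [RHS]eq_bsum do rewrite -(step_quotient _ (bu _) Z0).
rewrite (eq_psmul _ (fun=> erefl) D1) psmulC /psmul /vpair.
set q := vpair Lam (fun i => Op y i (fun=> 1)).
rewrite -/(vpair _ _).
transitivity (bsum (fun b c =>
    bsum (fun i j => q b * (cintegral (step y Lam i) (u j))) c) a).
  by apply: eq_bsum => b c; rewrite bsumZ.
rewrite -(bsumA (fun b i j => q b * (cintegral (step y Lam i) (u j)))).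
apply: eq_bsum => b c; rewrite bsumC.
by apply: eq_bsum => i j; rewrite mulrC.
Qed.

Definition iter_step l Lam := foldl (fun L y => step y L) Lam l.

(** The iterated update is again a quotient: normalising at every step or only
    at the end gives the same result. *)
Lemma iter_step_quotient y l Lam u : normalised Lam -> bmeass u ->
  psmul (vpair (iter_step (y :: l) Lam) u) (vpair Lam (bwd1 Op (y :: l))) =1
  vpair Lam (bwd Op (y :: l) u).
Proof.
elim: l y Lam => [|y1 l ih] y Lam nL bu a; first exact: step_series.
have nL1 := normalised_step y nL.
have bm v : bmeass v -> bmeass (bwd Op (y1 :: l) v).
  exact: (bwd_bmeass Op_bmeas).
have b1s : bmeass (cser (fun _ : X => 1 : R) : mindex d p -> X -> R).
  exact: bmeas_cser.
rewrite -[RHS](step_series y nL (bm _ bu)).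
rewrite -(eq_psmul _ (ih y1 _ nL1 bu) (fun=> erefl)) psmulA.
apply: eq_psmul => // b; rewrite -[LHS](step_series y nL (bm _ b1s)).
by [].
Qed.

Lemma tvnorm_le_vnorm Lam a : tvnorm (Lam a) <= vnorm Lam.
Proof. exact: le_bigmax. Qed.

Lemma vnorm_ge0 Lam : 0 <= vnorm Lam.
Proof. exact: le_trans (tvnorm_ge0 _) (tvnorm_le_vnorm Lam mindex0). Qed.

Lemma vnorm_ge1 Lam : normalised Lam -> 1 <= vnorm Lam.
Proof.
move=> [_ L1]; apply: le_trans (tvnorm_le_vnorm Lam mindex0).
rewrite -[leRHS]mulr1 -{1}L1 (le_trans (ler_norm _))//.
by apply: cintegral_bnd => // x; rewrite normr1.
Qed.

Lemma vnorm_le Lam (C : R) : 0 <= C ->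
  (forall a g, bmeas g -> (forall x, `|g x| <= 1) ->
     `|cintegral (Lam a) g| <= C) -> vnorm Lam <= C.
Proof.
move=> C0 LC; apply: bigmax_le => // a _; apply: tvnorm_le => g bg g1.
exact: le_trans (ler_norm _) (LC a g bg g1).
Qed.

Lemma vpair_bound Lam u (S M : R) a : bmeass u -> 0 <= S -> 0 <= M ->
  (forall b x, `|u b x| <= S * M ^+ mabs b) ->
  `|vpair Lam u a| <= vnorm Lam * S * (1 + M) ^+ mabs a.
Proof.
move=> bu S0 M0 uS; rewrite -bsum_pow -bsumZ; apply: bsum_le_norm => b c.
apply: (le_trans (cintegral_bnd _ (bu c) (uS c))).
rewrite expr1n mul1r mulrA ler_wpM2r ?exprn_ge0// ler_wpM2r//.
exact: tvnorm_le_vnorm.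
Qed.

Section bounds.
Variables (l : seq Y).
Hypothesis l_gt0 : (0 < size l)%N.

Let h := bwd1 Op l.
Let Psi := psis psi l.

Let bh : bmeass h. Proof. exact: (bwd1_bmeass Op_bmeas). Qed.
Let h_gt0 x : 0 < h mindex0 x.
Proof. exact: (bwd1_gt0 e01 Op_bmeas Op_lin Op_mono Op_cmp Op1_gt0). Qed.
Let h_cmp x x1 : e * h mindex0 x1 <= h mindex0 x.
Proof. exact: (bwd1_cmp_gt0 e01 Op_bmeas Op_lin Op_mono Op_cmp Op1_gt0 l).1. Qed.

Lemma psis_ge1 : 1 <= Psi.
Proof.
rewrite /Psi; case: l l_gt0 => // y l' _; rewrite psis_cons.
by rewrite -[leLHS]addr0 lerD// psis_ge0.
Qed.

Let beta Lam := cintegral (Lam mindex0) (h mindex0).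

Let beta_gt0 Lam : normalised Lam -> 0 < beta Lam.
Proof.
move=> nL; apply: (@normalised_gt0 _ _ (e * h mindex0 point)) => //.
by rewrite mulr_gt0.
Qed.

Let h_le Lam x : normalised Lam -> h mindex0 x <= e^-1 * beta Lam.
Proof.
move=> nL; rewrite ler_pdivlMl// -(normalised_cst (e * h mindex0 x) nL).
by apply: normalised_le => //; exact: bmeas_cst.
Qed.

Lemma vpair_bound_bwd Lam0 Lam u (t M : R) a : normalised Lam ->
  bmeass u -> 0 <= t -> 0 <= M ->
  (forall b x, `|u b x| <= t * M ^+ mabs b * h mindex0 x) ->
  `|vpair Lam0 u a| <=
    e^-1 * vnorm Lam0 * t * (1 + M) ^+ mabs a * beta Lam.
Proof.
move=> nL bu t0 M0 uM; have bt0 := beta_gt0 nL.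
rewrite [leRHS](_ : _ = vnorm Lam0 * (t * (e^-1 * beta Lam)) *
  (1 + M) ^+ mabs a); last by ring.
apply: vpair_bound => //; first by
  rewrite mulr_ge0// mulr_ge0 ?invr_ge0 ?(ltW e0) ?(ltW bt0).
move=> b x; apply: (le_trans (uM b x)).
by rewrite mulrAC ler_wpM2r ?exprn_ge0// ler_wpM2l// h_le.
Qed.

Let h_bound (M : R) b x : Psi <= M ->
  `|h b x| <= 1 * M ^+ mabs b * h mindex0 x.
Proof.
move=> PM; have P1 := psis_ge1.
rewrite mul1r; apply: (@le_trans _ _ (Psi ^+ mabs b * h mindex0 x)).
  apply: (bwd_bound psi0 Op_bmeas Op_lin Op_mono Op_dom) => // x1.
  by rewrite normr1.
by rewrite ler_wpM2r ?(ltW (h_gt0 x))// lerXn2r ?nnegrE//; lra.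
Qed.

Let ei1 : 1 <= e^-1.
Proof. by rewrite invr_ge1 ?unitfE ?gt_eqF//; have /andP[_ /ltW] := e01. Qed.

(** [quotient_bound] for a quotient of two pairings. At order [0] positivity
    bounds the numerator without a factor [vnorm Lam], and the denominator is
    not small; so the norm enters once per order of differentiation, and its
    power is at most [p]. *)
Lemma ratio_bound Lam (q : mindex d p -> R) u (t M L : R) :
  normalised Lam -> bmeass u -> 0 <= t -> Psi <= M -> vnorm Lam <= L ->
  (forall b x, `|u b x| <= t * M ^+ mabs b * h mindex0 x) ->
  psmul q (vpair Lam h) =1 vpair Lam u ->
  forall a, `|q a| <= t * (2 * (e^-1 * L * 2 ^+ p * (1 + M))) ^+ mabs a.
Proof.
move=> nL bu t0 PM LL uM qE.
have P1 := psis_ge1; have e1 := ei1.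
have bt0 := beta_gt0 nL.
have L1 : 1 <= L by rewrite (le_trans (vnorm_ge1 nL)).
have eL1 : 1 <= e^-1 * L by rewrite mulr_ege1.
set N := e^-1 * L * 2 ^+ p * (1 + M).
have M0 : 0 <= M by lra.
have bound v (s : R) : bmeass v -> 0 <= s ->
    (forall b x, `|v b x| <= s * M ^+ mabs b * h mindex0 x) ->
    forall a, `|vpair Lam v a| <= e^-1 * L * s * (1 + M) ^+ mabs a * beta Lam.
  move=> bv s0 vM a; apply: (le_trans (vpair_bound_bwd Lam a nL bv s0 M0 vM)).
  rewrite ler_wpM2r ?(ltW bt0)// ler_wpM2r ?exprn_ge0 ?addr_ge0//.
  by rewrite ler_wpM2r// ler_wpM2l//; lra.
have b0E : vpair Lam h mindex0 = beta Lam by rewrite /vpair bsum0.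
have p1 : 1 <= 2 ^+ p :> R by rewrite exprn_ege1// ler1n.
have MN : 1 + M <= N.
  by rewrite /N ler_peMl ?addr_ge0// mulr_ege1.
apply: (quotient_bound (k := e^-1 * L) (M := 1 + M) qE) => //.
- by rewrite b0E.
- by lra.
- by lra.
- move=> a; rewrite b0E.
  have [->|a0] := eqVneq a mindex0.
    rewrite mabs0 expr0 mulr1 /vpair bsum0.
    have ub x : `|u mindex0 x| <= t * h mindex0 x.
      by have := uM mindex0 x; rewrite mabs0 expr0 mulr1.
    have le1 : cintegral (Lam mindex0) (u mindex0) <= t * beta Lam.
      rewrite -cintegralZ//; apply: normalised_le => //; first exact: bmeasZ.
      by move=> x; rewrite (le_trans (ler_norm _)).
    have le2 : cintegral (Lam mindex0) (fun x => - t * h mindex0 x) <=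
        cintegral (Lam mindex0) (u mindex0).
      apply: normalised_le => //; first exact: bmeasZ.
      by move=> x; have := ub x; rewrite ler_norml => /andP[+ _]; rewrite mulNr.
    rewrite cintegralZ// mulNr in le2.
    by rewrite ler_norml le1 le2.
  apply: (le_trans (bound u t bu t0 uM a)).
  rewrite ler_wpM2r ?(ltW bt0)// (mulrC _ t) -mulrA ler_wpM2l//.
  have := mabs_gt0 a0; case: (mabs a) => // j _.
  rewrite !exprS mulrA ler_pM//.
  + by rewrite !mulr_ge0// ?addr_ge0//; lra.
  + by rewrite exprn_ge0// addr_ge0.
  + by rewrite /N ler_wpM2r ?addr_ge0// ler_peMr//; lra.
  + by rewrite lerXn2r ?nnegrE ?addr_ge0// (le_trans _ MN)// addr_ge0.
- move=> a _; have := bound h 1 bh ler01 (fun b x => h_bound b x PM) a.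
  by rewrite b0E mulr1.
Qed.

Lemma iter_step_pairing Lam g : normalised Lam -> bmeas g ->
  psmul (fun a => cintegral (iter_step l Lam a) g) (vpair Lam h) =1
  vpair Lam (bwd Op l (cser g)).
Proof.
move=> nL bg; rewrite /h; case: l l_gt0 => // y l' _ a.
rewrite -iter_step_quotient//; last exact: bmeas_cser.
by apply: eq_psmul => // b; rewrite vpair_cser.
Qed.

Lemma iter_step_growth Lam : normalised Lam ->
  vnorm (iter_step l Lam) <= (4 * 2 ^+ p / e) ^+ p * vnorm Lam ^+ p * Psi ^+ p.
Proof.
move=> nL; have e1 := ei1; have P1 := psis_ge1; have L1 := vnorm_ge1 nL.
have p1 : 1 <= 2 ^+ p :> R by rewrite exprn_ege1// ler1n.
rewrite -!exprMn.
set C := 4 * 2 ^+ p / e * vnorm Lam * Psi.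
have eL : 1 <= e^-1 * vnorm Lam * 2 ^+ p by rewrite !mulr_ege1.
have C1 : 2 * (e^-1 * vnorm Lam * 2 ^+ p * (1 + Psi)) <= C.
  rewrite /C (_ : 4 * 2 ^+ p / e * _ * _ =
    2 * (e^-1 * vnorm Lam * 2 ^+ p * (2 * Psi))); last by ring.
  by rewrite ler_wpM2l// ler_wpM2l; lra.
have C2 : 1 <= 2 * (e^-1 * vnorm Lam * 2 ^+ p * (1 + Psi)).
  by rewrite !mulr_ege1 ?ler1n//; lra.
apply: vnorm_le => [|a g bg g1]; first by rewrite exprn_ge0//; lra.
have := @ratio_bound Lam _ (bwd Op l (cser g)) 1 Psi (vnorm Lam) nL
  (bwd_bmeass Op_bmeas _ (bmeas_cser bg)) ler01 (lexx _) (lexx _) _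
  (iter_step_pairing nL bg) a.
rewrite mul1r => H; apply: (le_trans (H _)) => [b x|].
  by rewrite mul1r; exact: (bwd_bound psi0 Op_bmeas Op_lin Op_mono Op_dom).
apply: (@le_trans _ _ (C ^+ mabs a)).
  by rewrite lerXn2r ?nnegrE//; lra.
by rewrite ler_weXn2l ?mabs_le//; lra.
Qed.

(** Subtracting from the iterated update of [g] the centre [c] of the ratio
    [w = bwd l g / bwd l 1] gives the quotient [q Lam] of the pairings of
    [Lam] with [h (w - c)] and with [h], where [h = bwd l 1]. The numerator
    is small by [ratio_osc]. The difference of the quotients for [Lam] and
    [Lam'], multiplied by the pairing of [Lam] with [h], is an expression [E]
    that is linear in [Lam - Lam'] and keeps the small factor. *)
Lemma iter_step_stability (B : R) Lam Lam' :
  1 <= B -> 2 ^+ p <= B + 1 -> 12 * 8 ^+ p <= e ^+ 2 * B ->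
  normalised Lam -> normalised Lam' ->
  vnorm (vsub (iter_step l Lam) (iter_step l Lam')) <=
    4 / e * (6 * 2 ^+ p * (B + 2) / e) ^+ p * (1 - e ^+ 2 / 2) ^+ size l *
    vnorm (vsub Lam Lam') * (vnorm Lam + vnorm Lam') ^+ p * Psi ^+ p.
Proof.
move=> B1 pB eB nL nL'.
have e1 := ei1; have P1 := psis_ge1.
have L1 := vnorm_ge1 nL; have L1' := vnorm_ge1 nL'.
have p1 : 1 <= 2 ^+ p :> R by rewrite exprn_ege1// ler1n.
set tau := 1 - e ^+ 2 / 2; set L := vnorm Lam + vnorm Lam'.
set de := vnorm (vsub Lam Lam'); have de0 : 0 <= de by exact: vnorm_ge0.
have e21 : e ^+ 2 <= 1 by rewrite exprn_ile1 ?ltW//; have /andP[] := e01.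
have tau0 : 0 <= tau by rewrite /tau; lra.
pose t := 2 * tau ^+ size l.
have t0 : 0 <= t by rewrite mulr_ge0// exprn_ge0.
pose M := (B + 1) * Psi.
have PM : Psi <= M by rewrite ler_peMl//; lra.
have M0 : 0 <= M by lra.
have bt0 := beta_gt0 nL.
pose N := e^-1 * L * 2 ^+ p * (1 + M).
have LL : 1 <= L by rewrite /L; lra.
have eL : 1 <= e^-1 * L * 2 ^+ p by rewrite !mulr_ege1.
have MN : 1 + M <= N by rewrite /N ler_peMl//; lra.
pose C := 6 * 2 ^+ p * (B + 2) / e * L * Psi.
have NC : 6 * N <= C.
  rewrite /C /N (_ : 6 * 2 ^+ p * (B + 2) / e * L * Psi =
    6 * (e^-1 * L * 2 ^+ p * ((B + 2) * Psi))); last by ring.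
  by rewrite ler_wpM2l// ler_wpM2l; rewrite /M; lra.
have N6 : 1 <= 6 * N by lra.
have N3 : 1 + M <= 3 * N by lra.
have N23 : 2 * N + (1 + M) <= 3 * N by lra.
have M10 : 0 <= 1 + M by lra.
have N0 : 0 <= N by lra.
have C1 : 1 <= C by lra.
have B0 : 0 <= B by lra.
have eL0 : 0 <= e^-1 * vnorm Lam by rewrite mulr_ge0 ?vnorm_ge0//; lra.
have eLN : e^-1 * vnorm Lam * 2 ^+ p * (1 + M) <= 3 * N.
  apply: (@le_trans _ _ N); last by lra.
  rewrite /N ler_wpM2r// ler_wpM2r ?exprn_ge0// ler_wpM2l//; first by lra.
  by rewrite /L; lra.
rewrite [leRHS](_ : _ = 2 * t * de / e * C ^+ p); last first.
  by rewrite /C /t !exprMn; ring.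
have ei0 : 0 <= e^-1 by rewrite invr_ge0 ltW.
have tde0 : 0 <= 2 * t * de / e.
  by apply: mulr_ge0 => //; apply: mulr_ge0 => //; exact: mulr_ge0.
apply: vnorm_le => [|a g bg g1].
  by rewrite mulr_ge0// exprn_ge0// (le_trans ler01).
rewrite cintegral_csub//.
have [w [bw wE wosc]] := ratio_osc e01 psi0 Op_bmeas Op_lin Op_mono Op_dom
  Op_cmp Op1_gt0 B1 pB eB (lexx Psi) bg g1.
pose c b := w b point.
pose z b x := w b x - c b.
pose hz b x := psmul (z^~ x) (h^~ x) b.
have bz b : bmeas (z b) by apply: bmeasB => //; exact: bmeas_cst.
have bhz : bmeass hz by move=> b; apply: bmeas_bsum => i j; exact: bmeasM.
have bch : bmeass (fun b x => psmul c (h^~ x) b).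
  by move=> b; apply: bmeas_bsum => i j; exact: bmeasZ.
have bG : bmeass (bwd Op l (cser g)).
  by apply: (bwd_bmeass Op_bmeas); exact: bmeas_cser.
have psmulBl (u1 u2 v : mindex d p -> R) b :
    psmul (fun b => u1 b - u2 b) v b = psmul u1 v b - psmul u2 v b.
  by rewrite /psmul -bsumB; apply: eq_bsum => i j; rewrite mulrBl.
have zB b x : `|z b x| <= t * (B * Psi) ^+ mabs b.
  by rewrite /z ler_norml lerNl opprB !wosc.
have hzB b x : `|hz b x| <= t * M ^+ mabs b * h mindex0 x.
  rewrite /M mulrDl mul1r -bsum_pow mulrAC -bsumZ; apply: bsum_le_norm => i j.
  rewrite normrM (le_trans (ler_pM _ _ (zB i x) (h_bound j x (lexx _))))//.
  by rewrite le_eqVlt; apply/orP; left; apply/eqP; ring.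
pose q Lam b := cintegral (iter_step l Lam b) g - c b.
have qE Lam0 : normalised Lam0 ->
    psmul (q Lam0) (vpair Lam0 h) =1 vpair Lam0 hz.
  move=> nL0 b; rewrite psmulBl iter_step_pairing// -vpair_psmul// -vpairB//.
  congr (vpair Lam0 _ b); apply/funext => i; apply/funext => x.
  by rewrite /hz /z psmulBl wE.
have qB' : forall b, `|q Lam' b| <= t * (2 * N) ^+ mabs b.
  apply: (ratio_bound nL' bhz t0 PM _ hzB (qE _ nL')).
  by rewrite /L; lra.
pose E b := vpair (vsub Lam Lam') hz b -
  psmul (q Lam') (vpair (vsub Lam Lam') h) b.
have dE : psmul (fun b => q Lam b - q Lam' b) (vpair Lam h) =1 E.
  move=> b; rewrite psmulBl qE// /E vpair_vsub// -(qE _ nL').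
  have -> : psmul (q Lam') (vpair (vsub Lam Lam') h) b =
      psmul (q Lam') (vpair Lam h) b - psmul (q Lam') (vpair Lam' h) b.
    by rewrite -bsumB; apply: eq_bsum => i j; rewrite vpair_vsub// mulrBr.
  by ring.
have h1 b x := h_bound b x PM.
have EB b : `|E b| <= 2 * t * de / e * (3 * N) ^+ mabs b * beta Lam.
  have E1 := vpair_bound_bwd (vsub Lam Lam') b nL bhz t0 M0 hzB.
  have E2 : `|psmul (q Lam') (vpair (vsub Lam Lam') h) b| <=
      t * (e^-1 * de) * beta Lam * (2 * N + (1 + M)) ^+ mabs b.
    rewrite -bsum_pow -bsumZ; apply: bsum_le_norm => i j.
    rewrite normrM (le_trans (ler_pM _ _ (qB' i)
      (vpair_bound_bwd (vsub Lam Lam') j nL bh ler01 M0 h1)))//.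
    by rewrite le_eqVlt; apply/orP; left; apply/eqP; rewrite -/de; ring.
  apply: (le_trans (ler_normB _ _)); apply: (le_trans (lerD E1 E2)).
  pose S := t * de / e * beta Lam.
  have S0 : 0 <= S.
    by rewrite /S mulr_ge0 ?(ltW bt0)//; apply: mulr_ge0 => //; exact: mulr_ge0.
  rewrite [leRHS](_ : _ = S * (3 * N) ^+ mabs b + S * (3 * N) ^+ mabs b);
    last by rewrite /S; ring.
  apply: lerD.
    rewrite [leLHS](_ : _ = S * (1 + M) ^+ mabs b); last first.
      by rewrite /S -/de; ring.
    by rewrite ler_wpM2l// lerXn2r ?nnegrE ?addr_ge0// mulr_ge0.
  rewrite [leLHS](_ : _ = S * (2 * N + (1 + M)) ^+ mabs b); last first.
    by rewrite /S; ring.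
  by rewrite ler_wpM2l// lerXn2r ?nnegrE ?addr_ge0// mulr_ge0.
have -> : cintegral (iter_step l Lam a) g - cintegral (iter_step l Lam' a) g =
    q Lam a - q Lam' a by rewrite /q; ring.
have := quotient_bound (t := 2 * t * de / e) (k := e^-1 * vnorm Lam)
  (M := 1 + M) (N := 3 * N) dE.
have b0E : vpair Lam h mindex0 = beta Lam by rewrite /vpair bsum0.
rewrite b0E => H; apply: (le_trans (H _ _ _ _ _ _ _ _ a)) => //.
- move=> b _; have := vpair_bound_bwd Lam b nL bh ler01 M0 h1.
  by rewrite mulr1.
rewrite ler_wpM2l//.
rewrite (_ : 2 * (3 * N) = 6 * N); last by ring.
apply: (@le_trans _ _ (C ^+ mabs a)).
  by rewrite lerXn2r ?nnegrE// (le_trans ler01)// (le_trans N6).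
by rewrite ler_weXn2l ?mabs_le.
Qed.

End bounds.

End stability.

(** * The normalised update as a quotient of power series *)

Section update.
Context {disp : measure_display} {X : measurableType disp} {R : realType}.
Context {d p : nat} {Y : Type}.
Variable mu : {measure set X -> \bar R}.
Variable r : 'rV[R]_d -> Y -> X -> X -> R.
Variable theta : 'rV[R]_d.
Variable psi : Y -> R.
Variable e : R.
Implicit Types (y : Y) (a b c : mindex d p) (g : X -> R)
  (Lam : vmeas X R d p) (lam : {charge set X -> \bar R}).
Let k y a x' x := dr r theta y a x' x.
Hypothesis e01 : 0 < e < 1.
Hypothesis psi1 : forall y, 1 <= psi y.
Hypothesis k_meas : forall y a, measurable_fun setT (fun z => k y a z.1 z.2).
Hypothesis k_dom : forall y a x' x,
  `|k y a x' x| <= psi y ^+ mabs a * r theta y x' x.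
Hypothesis r_meas : forall y,
  measurable_fun setT (fun z : X * X => r theta y z.1 z.2).
Hypothesis r_ge0 : forall y x' x, 0 <= r theta y x' x.
Hypothesis r_cmp : forall y x x1,
  {ae mu, forall x', e * r theta y x' x1 <= r theta y x' x}.
Hypothesis r_int : forall y x, mu.-integrable setT (EFin \o (r theta y)^~ x).
Hypothesis r_pos : forall y x, 0 < \int[mu]_x' r theta y x' x.
Hypothesis r_norm : forall y (lam : probability X R),
  (\int[mu]_x' \int[lam]_x (r theta y x' x)%:E < +oo)%E.

Let e0 : 0 < e. Proof. by have /andP[] := e01. Qed.

Let psi0 y : 0 <= psi y. Proof. exact: le_trans (psi1 y). Qed.

(** The operator with kernel [d^a r]. Integrating test functions against the
    kernel turns all the measures of the statement into functionals, and the
    recursion for the filter into the iteration of these operators. *)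
Definition Dop y a g (x : X) : R := \int[mu]_x' (k y a x' x * g x').

Lemma k0E y x' x : k y mindex0 x' x = r theta y x' x.
Proof. by rewrite /k /dr mderiv0. Qed.

Lemma k_fubini (m : {finite_measure set X -> \bar R}) y a g : bmeas g ->
  [/\ measurable_fun setT (Dop y a g),
      mu.-integrable setT
        (EFin \o (fun x' => \int[m]_x (k y a x' x * g x'))) &
      \int[mu]_x' \int[m]_x (k y a x' x * g x') = \int[m]_x Dop y a g x].
Proof.
move=> [mg [C gC]].
have C0 : 0 <= C by exact: le_trans (gC point).
have := @kernel_fubini _ _ _ mu (r theta y) e e0 (r_meas y) (r_ge0 y)
  (r_cmp y) (r_int y) (r_norm y) m (fun z => k y a z.1 z.2 * g z.1)
  (psi y ^+ mabs a * C).
apply => [||z]; first by rewrite mulr_ge0 ?exprn_ge0.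
  by apply: measurable_funM => //; exact: (measurableT_comp mg measurable_fst).
by rewrite normrM mulrAC ler_pM.
Qed.

Lemma kg_integrable y a g x : bmeas g ->
  mu.-integrable setT (EFin \o (fun x' => k y a x' x * g x')).
Proof.
move=> bg; apply: integrable_mul_bmeas => //.
apply: (le_integrable measurableT _ _
  (integrableZl measurableT (psi y ^+ mabs a) (r_int y x))).
  apply/measurable_EFinP.
  exact: (measurableT_comp (k_meas y a) (pair2_measurable x)).
by move=> x' _; rewrite lee_fin (le_trans (k_dom _ _ _ _))// ler_norm.
Qed.

Lemma Dop_lin y a f g (t : R) x : bmeas f -> bmeas g ->
  Dop y a (fun x => f x + t * g x) x = Dop y a f x + t * Dop y a g x.
Proof.
move=> bf bg; rewrite /Dop -RintegralZl//; last exact: kg_integrable.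
rewrite -RintegralD//; first last.
- exact: (integrableZl measurableT t (kg_integrable y a x bg)).
- exact: kg_integrable.
by apply: eq_Rintegral => x' _; ring.
Qed.

Lemma DopZ y a g (t : R) x : bmeas g ->
  Dop y a (fun x => t * g x) x = t * Dop y a g x.
Proof.
move=> bg; rewrite /Dop -RintegralZl//; last exact: kg_integrable.
by apply: eq_Rintegral => x' _; rewrite mulrCA.
Qed.

Lemma Dop_mono y f g x : bmeas f -> bmeas g -> (forall x, f x <= g x) ->
  Dop y mindex0 f x <= Dop y mindex0 g x.
Proof.
move=> bf bg fg; apply: le_Rintegral => //; try exact: kg_integrable.
by move=> x' _; rewrite k0E ler_wpM2l.
Qed.

Lemma Dop_dom y a g x : bmeas g ->
  `|Dop y a g x| <= psi y ^+ mabs a * Dop y mindex0 (fun x => `|g x|) x.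
Proof.
move=> bg; rewrite /Dop -RintegralZl//; last first.
  by apply: kg_integrable; exact: bmeas_norm.
apply: (le_trans (le_normr_Rintegral _ _)) => //; first exact: kg_integrable.
apply: le_Rintegral => //.
- exact/integrable_norm/kg_integrable.
- exact: (integrableZl measurableT (psi y ^+ mabs a)
    (kg_integrable y mindex0 x (bmeas_norm bg))).
- by move=> x' _; rewrite normrM mulrA ler_wpM2r// k0E.
Qed.

Lemma Dop_cmp y g x x1 : bmeas g -> (forall x, 0 <= g x) ->
  e * Dop y mindex0 g x1 <= Dop y mindex0 g x.
Proof.
move=> bg g0; rewrite /Dop -RintegralZl//; last exact: kg_integrable.
have i1 := integrableZl measurableT e (kg_integrable y mindex0 x1 bg).
rewrite /Rintegral fine_le//.
- exact: (integrable_fin_num measurableT i1).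
- exact: (integrable_fin_num measurableT (kg_integrable y mindex0 x bg)).
apply: ae_ge0_le_integral => //.
- by move=> x' _; rewrite lee_fin k0E !mulr_ge0// ltW.
- exact: (measurable_int _ i1).
- by move=> x' _; rewrite lee_fin k0E mulr_ge0.
- exact: (measurable_int _ (kg_integrable y mindex0 x bg)).
- apply: filterS (r_cmp y x x1) => x' H _.
  by rewrite lee_fin !k0E mulrA ler_wpM2r.
Qed.

Lemma Dop1_gt0 y x : 0 < Dop y mindex0 (fun=> 1) x.
Proof.
have := r_pos y x; congr (0 < _).
by apply: eq_Rintegral => x' _; rewrite mulr1 k0E.
Qed.

Lemma Dop_bmeas y a g : bmeas g -> bmeas (Dop y a g).
Proof.
move=> bg; split.
  by have [] := k_fubini (mzero : {finite_measure set X -> \bar R}) y a bg.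
have [mg [C gC]] := bg.
exists (psi y ^+ mabs a * (C * (e^-1 * Dop y mindex0 (fun=> 1) point))) => x.
apply: (le_trans (Dop_dom _ _ _ bg)); rewrite ler_wpM2l ?exprn_ge0//.
have b1 := @bmeas_cst _ X R 1.
apply: (@le_trans _ _ (C * Dop y mindex0 (fun=> 1) x)).
  rewrite -DopZ//; apply: Dop_mono => [||x']; [exact: bmeas_norm| |].
    by apply: bmeasZ.
  by rewrite mulr1.
rewrite ler_wpM2l ?(le_trans _ (gC point))// ler_pdivlMl//.
exact: Dop_cmp.
Qed.

Let b1 : bmeas (fun _ : X => 1 : R). Proof. exact: bmeas_cst. Qed.

Lemma rdens_mulE y a lam g x' : rdens r theta y a x' lam * g x' =
  \int[jordan_pos (hahn_posneg lam)]_x (k y a x' x * g x') -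
  \int[jordan_neg (hahn_posneg lam)]_x (k y a x' x * g x').
Proof.
rewrite /rdens /cintegral mulrBl -!Rintegral_mulr_cst//;
  exact: (measurableT_comp (k_meas y a) (pair1_measurable x')).
Qed.

Lemma rdens_integrable y a lam : mu.-integrable setT
  (EFin \o (fun x' => rdens r theta y a x' lam)).
Proof.
have [_ ip _] := k_fubini (jordan_pos (hahn_posneg lam)) y a b1.
have [_ im _] := k_fubini (jordan_neg (hahn_posneg lam)) y a b1.
have := integrableB measurableT ip im; congr (_.-integrable _ _).
apply/funext => x' /=; rewrite -EFinB; congr EFin.
by rewrite -(rdens_mulE y a lam (fun=> 1)) mulr1.
Qed.

Lemma rdens_pairing y a lam g : bmeas g ->
  \int[mu]_x' (rdens r theta y a x' lam * g x') = cintegral lam (Dop y a g).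
Proof.
move=> bg.
have [_ ip Ep] := k_fubini (jordan_pos (hahn_posneg lam)) y a bg.
have [_ im Em] := k_fubini (jordan_neg (hahn_posneg lam)) y a bg.
rewrite /cintegral -Ep -Em -RintegralB//.
by apply: eq_Rintegral => x' _; exact: rdens_mulE.
Qed.

(** Before normalisation, the update acts on test functions by the transposed
    operators. *)
Lemma sdens_pairing y a Lam g : bmeas g ->
  mu.-integrable setT (EFin \o (fun x => sdens mu r theta y a x Lam)) /\
  \int[mu]_x (sdens mu r theta y a x Lam * g x) =
    (cintegral (Lam mindex0) (Dop y mindex0 (fun=> 1)))^-1 *
    vpair Lam (fun b => Dop y b g) a.
Proof.
move=> bg.
pose Z := \int[mu]_x rdens r theta y (mindex0 : mindex d p) x (Lam mindex0).
have ZE : Z = cintegral (Lam mindex0) (Dop y mindex0 (fun=> 1)).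
  rewrite -rdens_pairing//; apply: eq_Rintegral => x _; by rewrite mulr1.
have sE x : sdens mu r theta y a x Lam = \sum_(b | mle b a)
    ((mbin a b)%:R * Z^-1) * rdens r theta y (msub a b) x (Lam b).
  by apply: eq_bigr => b _; rewrite -mulrA (mulrC Z^-1).
have [is_ _] := Rintegral_sum (mle^~ a) (fun b => (mbin a b)%:R * Z^-1)
  (fun b => rdens_integrable y (msub a b) (Lam b)).
split; first by under eq_fun do rewrite sE.
have ig b := integrable_mul_bmeas (rdens_integrable y (msub a b) (Lam b)) bg.
have [_] := Rintegral_sum (mle^~ a) (fun b => (mbin a b)%:R * Z^-1) ig.
rewrite -ZE /vpair /bsum mulr_sumr => H.
transitivity (\int[mu]_x (\sum_(b | mle b a) (mbin a b)%:R * Z^-1 *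
    (rdens r theta y (msub a b) x (Lam b) * g x))).
  apply: eq_Rintegral => x _; rewrite sE mulr_suml.
  by apply: eq_bigr => b _; rewrite mulrA.
rewrite H; apply: eq_bigr => b _; rewrite rdens_pairing//.
by rewrite mulrCA mulrA.
Qed.

Lemma fdens_integrable y a Lam :
  mu.-integrable setT (EFin \o (fun x => fdens mu r theta y a x Lam)).
Proof.
have [n] := ubnP (mabs a); elim: n a => // n ih a an.
have [is_ _] := sdens_pairing y a Lam b1.
pose G b := if mle b a && (b != a) then fdens mu r theta y b ^~ Lam
  else (fun=> 0).
have iG b : mu.-integrable setT (EFin \o G b).
  rewrite /G; case: ifPn => [/andP[ba nba]|_]; last exact: integrable0.
  by apply: ih; rewrite (leq_trans (mle_abs_lt ba nba)).
have [iS _] := Rintegral_sum (fun b => mle b a && (b != a))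
  (fun b => (mbin a b)%:R * \int[mu]_x sdens mu r theta y (msub a b) x Lam) iG.
have := integrableB measurableT is_ iS; congr (_.-integrable _ _).
apply/funext => x /=; rewrite -EFinB fdensE; congr (EFin (_ - _)).
by apply: eq_bigr => b bP; rewrite /G bP mulrAC.
Qed.

(** Multiplied by the normalising power series, the recursion that defines [f]
    says that the updated vector measure is the quotient of two pairings. *)
Lemma Fstep_quotient y Lam g a : bmeas g ->
  0 < cintegral (Lam mindex0) (Dop y mindex0 (fun=> 1)) ->
  psmul (fun b => cintegral (Fstep mu r theta y Lam b) g)
    (vpair Lam (fun b => Dop y b (fun=> 1))) a =
  vpair Lam (fun b => Dop y b g) a.
Proof.
move=> bg Z0; set Z := cintegral _ _ in Z0.
have FE b : cintegral (Fstep mu r theta y Lam b) g =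
    \int[mu]_x (fdens mu r theta y b x Lam * g x).
  by rewrite cintegral_density//; exact: fdens_integrable.
have S1 b : \int[mu]_x sdens mu r theta y b x Lam =
    Z^-1 * vpair Lam (fun b => Dop y b (fun=> 1)) b.
  have [_ <-] := sdens_pairing y b Lam b1.
  by apply: eq_Rintegral => x _; rewrite mulr1.
suff H : psmul (fun b => cintegral (Fstep mu r theta y Lam b) g)
    (fun b => \int[mu]_x sdens mu r theta y b x Lam) a =
    \int[mu]_x (sdens mu r theta y a x Lam * g x).
  have [_ E] := sdens_pairing y a Lam bg; move: H; rewrite E.
  rewrite (eq_psmul _ (fun=> erefl) S1) /psmul.
  under eq_bsum do rewrite mulrCA.
  by rewrite bsumZ => /mulfI; apply; rewrite invr_eq0 gt_eqF.
have [is_ _] := sdens_pairing y a Lam b1.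
rewrite psmulE S1 (_ : vpair _ _ _ = Z); last by rewrite /vpair bsum0.
rewrite mulVf ?gt_eqF// mulr1 FE.
pose w b := (mbin a b)%:R * \int[mu]_x sdens mu r theta y (msub a b) x Lam.
have ifg b := integrable_mul_bmeas (fdens_integrable y b Lam) bg.
have [iS ES] := Rintegral_sum (fun b => mle b a && (b != a)) w ifg.
have -> : \int[mu]_x (fdens mu r theta y a x Lam * g x) =
    \int[mu]_x (sdens mu r theta y a x Lam * g x) -
    \sum_(b | mle b a && (b != a))
      w b * \int[mu]_x (fdens mu r theta y b x Lam * g x).
  rewrite -ES -RintegralB//; last exact: integrable_mul_bmeas.
  apply: eq_Rintegral => x _; rewrite fdensE mulrBl; congr (_ - _).
  by rewrite mulr_suml; apply: eq_bigr => b _; rewrite /w; ring.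
rewrite addrCA [X in _ + X](_ : _ = 0) ?addr0//; apply/eqP; rewrite subr_eq0.
by apply/eqP; apply: eq_bigr => b _; rewrite FE /w; ring.
Qed.

Lemma isL0_normalised Lam : isL0 Lam -> normalised Lam.
Proof.
move=> [pos one]; split=> [g bg g0|]; first exact: cintegral_ge0_prob.
rewrite (_ : (fun=> 1) = \1_setT) ?cintegral_indic//.
  by move: one => /= ->.
by apply/funext => x; rewrite indicT.
Qed.

Lemma Fiter_iter_step (ys : nat -> Y) (m n : nat) Lam :
  Fiter mu r theta ys m (m + n) Lam =
  iter_step (Fstep mu r theta) (map ys (iota m.+1 n)) Lam.
Proof.
elim: n => [|n ih]; first by rewrite addn0 Fiter_start.
rewrite addnS Fiter_step ?leq_addr// ih -(addn1 n) iotaD map_cat.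
by rewrite /iter_step foldl_cat /= addSn.
Qed.

Lemma psi_sum_psis (ys : nat -> Y) (m n : nat) :
  psi_sum psi ys m (m + n.+1) = psis psi (map ys (iota m.+1 n.+1)).
Proof.
rewrite /psi_sum (_ : (m + n.+1 == m)%N = false); last by lia.
rewrite /psis big_map.
by rewrite /index_iota subSS addKn.
Qed.

Lemma Fiter_bounds (B : R) (ys : nat -> Y) (m n : nat) Lam Lam' :
  1 <= B -> 2 ^+ p <= B + 1 -> 12 * 8 ^+ p <= e ^+ 2 * B ->
  isL0 Lam -> isL0 Lam' ->
  vnorm (Fiter mu r theta ys m (m + n.+1) Lam) <=
    (4 * 2 ^+ p / e) ^+ p * vnorm Lam ^+ p * psi_sum psi ys m (m + n.+1) ^+ p /\
  vnorm (vsub (Fiter mu r theta ys m (m + n.+1) Lam)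
              (Fiter mu r theta ys m (m + n.+1) Lam')) <=
    4 / e * (6 * 2 ^+ p * (B + 2) / e) ^+ p * (1 - e ^+ 2 / 2) ^+ n.+1 *
    vnorm (vsub Lam Lam') * (vnorm Lam + vnorm Lam') ^+ p *
    psi_sum psi ys m (m + n.+1) ^+ p.
Proof.
move=> B1 pB eB /isL0_normalised nL /isL0_normalised nL'.
rewrite !Fiter_iter_step psi_sum_psis.
set l := map ys (iota m.+1 n.+1).
have sl : size l = n.+1 by rewrite size_map size_iota.
have l0 : (0 < size l)%N by rewrite sl.
split.
  exact: (iter_step_growth e01 psi1 Dop_bmeas Dop_lin Dop_mono Dop_dom Dop_cmp
    Dop1_gt0 Fstep_quotient l0 nL).
rewrite -sl.
exact: (iter_step_stability e01 psi1 Dop_bmeas Dop_lin Dop_mono Dop_dom Dop_cmp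
  Dop1_gt0 Fstep_quotient l0 B1 pB eB nL nL').
Qed.

End update.

(** * Constants that depend on the order and the mixing rate only *)

(* pk theta x x' and q theta x y stand for p_theta(x' | x) and q_theta(y | x). *)
Theorem theorem2p2 (R : realType) (p : nat) (eps : R) :
  (1 <= p)%N -> 0 < eps < 1 ->
  exists tau K : R, [/\ 0 < tau < 1, 1 <= K &
  forall (d dx dy : nat) (Theta : set 'rV[R]_d)
    (Xs : set 'rV[R]_dx) (Ys : set 'rV[R]_dy) (x0 : Xs) (y0 : Ys)
    (X := borel_sub x0) (Y := borel_sub y0)
    (mu : {measure set X -> \bar R}) (nu : {measure set Y -> \bar R})
    (pk : 'rV[R]_d -> X -> X -> R) (q : 'rV[R]_d -> X -> Y -> R)
    (r := fun theta (y : Y) (x' x : X) => q theta x' y * pk theta x x')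
    (psi : Y -> R),
  (1 <= d)%N -> (1 <= dx)%N -> (1 <= dy)%N ->
  bounded_set Theta -> open Theta ->
  (@open 'rV[R]_dx).-sigma.-measurable Xs ->
  (@open 'rV[R]_dy).-sigma.-measurable Ys ->
  (forall theta x x', Theta theta -> 0 <= pk theta x x') ->
  (forall theta x y, Theta theta -> 0 <= q theta x y) ->
  (forall theta, Theta theta ->
     measurable_fun setT (fun z : X * X => pk theta z.1 z.2)) ->
  (forall theta, Theta theta ->
     measurable_fun setT (fun z : X * Y => q theta z.1 z.2)) ->
  (forall theta x, Theta theta ->
     (\int[mu]_x' (pk theta x x')%:E = 1)%E) ->
  (forall theta x, Theta theta ->
     (\int[nu]_y (q theta x y)%:E = 1)%E) ->
  (forall x x', ntimes_differentiable p Theta (fun t => pk t x x')) ->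
  (forall x y, ntimes_differentiable p Theta (fun t => q t x y)) ->
  normalizable mu r Theta ->
  (forall theta y, Theta theta ->
     exists mu_y : {measure set X -> \bar R},
       (0 < mu_y setT < +oo)%E /\
       forall x B, measurable B ->
         (eps%:E * mu_y B <= \int[mu]_(x' in B) (r theta y x' x)%:E /\
          \int[mu]_(x' in B) (r theta y x' x)%:E <= eps^-1%:E * mu_y B)%E) ->
  (forall y, 1 <= psi y) ->
  (forall theta x x' y (a : mindex d p), Theta theta -> a != mindex0 ->
     `|dr r theta y a x' x| <= psi y ^+ mabs a * r theta y x' x) ->
  forall theta (Lam Lam' : vmeas X R d p) (m n : nat) (ys : nat -> Y),
    Theta theta -> isL0 Lam -> isL0 Lam' -> (m <= n)%N ->
    vnorm (Fiter mu r theta ys m n Lam) <=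
      K * vnorm Lam ^+ p * psi_sum psi ys m n ^+ p /\
    vnorm (vsub (Fiter mu r theta ys m n Lam) (Fiter mu r theta ys m n Lam'))
      <= K * tau ^+ (n - m) * vnorm (vsub Lam Lam') *
         (vnorm Lam + vnorm Lam') ^+ p * psi_sum psi ys m n ^+ p].
Proof.
move=> p1 /andP[eps0 eps1].
(* [e] compares the kernels started at two points, each being within a factor
   [eps] of the same measure *)
pose e := eps ^+ 2.
have e0 : 0 < e by rewrite exprn_gt0.
have e1 : e < 1 by rewrite exprn_ilt1// ltW.
have e01 : 0 < e < 1 by rewrite e0.
have e20 : 0 < e ^+ 2 by rewrite exprn_gt0.
have e21 : e ^+ 2 < 1 by rewrite exprn_ilt1// ltW.
(* the smallest [B] that [ratio_osc] allows *)
pose B := 12 * 8 ^+ p / e ^+ 2.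
have p8 : 1 <= 8 ^+ p :> R by rewrite exprn_ege1// ler1n.
have p2 : 1 <= 2 ^+ p :> R by rewrite exprn_ege1// ler1n.
have p28 : 2 ^+ p <= 8 ^+ p :> R by rewrite lerXn2r ?nnegrE// ler_nat.
have eB : 12 * 8 ^+ p <= e ^+ 2 * B.
  by rewrite /B mulrCA divff ?mulr1 ?gt_eqF.
have B12 : 12 * 8 ^+ p <= B.
  by rewrite /B ler_peMr ?mulr_ge0 ?invr_ge1 ?unitfE ?gt_eqF ?ltW//; lra.
have B1 : 1 <= B by lra.
have pB : 2 ^+ p <= B + 1 by lra.
have ei1 : 1 <= e^-1 by rewrite invr_ge1 ?unitfE ?gt_eqF ?ltW.
(* [C1 ^+ p] bounds the growth, [4 / e * C2 ^+ p] the difference *)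
pose C1 := 4 * 2 ^+ p / e; pose C2 := 6 * 2 ^+ p * (B + 2) / e.
pose K := 4 / e * C2 ^+ p.
have C1_ge1 : 1 <= C1 by rewrite /C1 !mulr_ege1// ler1n.
have C12 : C1 <= C2.
  rewrite /C1 /C2 ler_wpM2r ?invr_ge0 ?(ltW e0)//.
  by rewrite mulrAC ler_wpM2r ?exprn_ge0//; lra.
have K1 : 1 <= K.
  apply: mulr_ege1; last exact: exprn_ege1 (le_trans C1_ge1 C12).
  by apply: mulr_ege1 => //; rewrite ler1n.
have C1K : C1 ^+ p <= K.
  rewrite /K -[leLHS]mul1r ler_pM ?mulr_ege1 ?ler1n ?exprn_ge0//; first by lra.
  by rewrite lerXn2r ?nnegrE//; lra.
exists (1 - e ^+ 2 / 2), K; split => //; first by apply/andP; split; lra.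
move=> d dx dy Theta Xs Ys x0 y0 X Y mu nu pk q r psi d1 dx1 dy1 bTheta oTheta
  mXs mYs pk0 q0 mpk mq intpk intq dpk dq norm_r mu_y psi1 dom_r
  theta Lam Lam' m n ys Dt L0 L0' mn.
have r_ge0 y x' x : 0 <= r theta y x' x by rewrite mulr_ge0 ?pk0 ?q0.
have r_meas_t t y : Theta t ->
    measurable_fun setT (fun z : X * X => r t y z.1 z.2).
  move=> Tt; apply: measurable_funM.
    have mz : measurable_fun setT (fun z : X * X => (z.1, y)).
      by apply/measurable_fun_pair => //; exact: measurable_cst.
    exact: (measurableT_comp (mq t Tt) mz).
  exact: (measurableT_comp (mpk t Tt) (@measurable_swap _ _ X X)).
have k_meas y (a : mindex d p) :
    measurable_fun setT (fun z : X * X => dr r theta y a z.1 z.2).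
  apply: (measurable_mderiv (D := Theta) a (F := fun t (z : X * X) =>
    r t y z.1 z.2)) => // [t Tt|z]; first exact: r_meas_t.
  apply: (ntimes_pderivableM (f := fun t => q t z.1 y)
    (g := fun t => pk t z.2 z.1)).
  - exact: oTheta.
  - exact/ntimes_differentiable_pderivable/dq.
  - exact/ntimes_differentiable_pderivable/dpk.
have k_dom y (a : mindex d p) x' x :
    `|dr r theta y a x' x| <= psi y ^+ mabs a * r theta y x' x.
  have [->|a0] := eqVneq a mindex0; last exact: dom_r.
  by rewrite mabs0 expr0 mul1r /dr mderiv0 ger0_norm.
have r_int y x : mu.-integrable setT (EFin \o (r theta y)^~ x).
  apply/integrableP; split.
    apply/measurable_EFinP.
    exact: (measurableT_comp (r_meas_t theta y Dt) (pair2_measurable x)).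
  have [my [/andP[my0 my1] myB]] := mu_y theta y Dt.
  have [_ H] := myB x setT measurableT.
  under eq_integral do rewrite /= ger0_norm//.
  apply: (le_lt_trans H).
  by rewrite lte_mul_pinfty// lee_fin invr_ge0 ltW.
have r_pos y x : 0 < \int[mu]_x' r theta y x' x.
  have [my [/andP[my0 my1] myB]] := mu_y theta y Dt.
  have [H _] := myB x setT measurableT.
  rewrite fine_gt0//; apply/andP; split.
    by apply: lt_le_trans H; rewrite mule_gt0 ?lte_fin.
  by rewrite ltey_eq (integrable_fin_num measurableT (r_int y x)).
have r_cmp y x x1 : {ae mu, forall x', e * r theta y x' x1 <= r theta y x' x}.
  apply: ae_le_of_integral_le => [||A mA].
  - exact: (integrableZl measurableT e (r_int y x1)).
  - exact: r_int.
  have [my [_ myB]] := mu_y theta y Dt.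
  have [H _] := myB x A mA; have [_ H1] := myB x1 A mA.
  apply: le_trans H.
  under eq_integral do rewrite EFinM.
  rewrite ge0_integralZl//; last 3 first.
  - apply: measurable_funTS; exact: (measurable_int _ (r_int y x1)).
  - by move=> x' _; rewrite lee_fin.
  - by rewrite lee_fin ltW.
  apply: (le_trans (lee_wpmul2l _ H1)); first by rewrite lee_fin ltW.
  rewrite muleA -EFinM /e (_ : eps ^+ 2 / eps = eps)//.
  by rewrite expr2 mulfK ?gt_eqF.
have r_norm y (lam : probability X R) :
  (\int[mu]_x' \int[lam]_x (r theta y x' x)%:E < +oo)%E by exact: norm_r.
(* for [n = m] both bounds only need [1 <= vnorm Lam] *)
have [n0|nk] : n = m \/ exists k, n = (m + k.+1)%N.
  move: mn; rewrite leq_eqVlt => /orP[/eqP ->|mn]; [by left|right].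
  by exists (n - m.+1)%N; rewrite -addSnnS subnKC.
- have nL := isL0_normalised L0; have nL' := isL0_normalised L0'.
  have L1 := vnorm_ge1 nL; have L1' := vnorm_ge1 nL'.
  rewrite n0 !Fiter_start /psi_sum eqxx expr1n !mulr1 subnn expr0 mulr1.
  split.
    rewrite -[leLHS]mul1r ler_pM ?vnorm_ge0//.
    by rewrite -[leLHS]expr1 ler_weXn2l.
  rewrite mulrAC ler_peMl ?vnorm_ge0// mulr_ege1// exprn_ege1//.
  by rewrite (le_trans L1)// lerDl vnorm_ge0.
have [k ->] := nk.
have [G D] := Fiter_bounds e01 psi1 k_meas k_dom (fun y => r_meas_t theta y Dt)
  r_ge0 r_cmp r_int r_pos r_norm ys m k B1 pB eB L0 L0'.
have sum0 : 0 <= psi_sum psi ys m (m + k.+1).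
  rewrite /psi_sum; case: ifP => // _; apply: sumr_ge0 => i _.
  exact: le_trans (psi1 _).
split; last by rewrite addKn.
apply: (le_trans G); rewrite ler_wpM2r ?exprn_ge0// ler_wpM2r// exprn_ge0//.
exact: vnorm_ge0.
Qed.
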